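(* Let $p\in\mathbb C\setminus\mathbb Z_{<0}$ and $r\in\mathbb C$. Then $\mathcal F_{p,r}\cong V[p,r]$ as modules for $V^{\mathcal{SH}}(c_L,c_{L,\alpha})$ (equivalently, as $\mathcal{SH}$-modules).
   Context: The $N=1$ Heisenberg-Virasoro algebra $\mathcal{SH}$ is the complex Lie superalgebra with even basis elements $L(n),\alpha(n)$ ($n\in\mathbb Z$), odd basis elements $G(n+\frac12),\Psi(n+\frac12)$ ($n\in\mathbb Z$), and even central elements $C_L,C_\alpha,C_{L,\alpha}$, with (super)commutators, for $m,n\in\mathbb Z$: $[\alpha(m),\alpha(n)]=\delta_{m+n,0}\,m\,C_\alpha$; $[L(m),\alpha(n)]=-n\,\alpha(m+n)-\delta_{m+n,0}(m^2+m)C_{L,\alpha}$; $[L(m),L(n)]=(m-n)L(m+n)+\delta_{m+n,0}\frac{m^3-m}{12}C_L$; $[\Psi(m+\frac12),\Psi(n+\frac12)]_+=\delta_{m+n+1,0}C_\alpha$; $[\alpha(m),\Psi(n+\frac12)]=0$; $[G(m+\frac12),G(n+\frac12)]_+=2L(m+n+1)+\delta_{m+n+1,0}\frac{m^2+m}{3}C_L$; $[L(m),G(n+\frac12)]=(\frac m2-n-\frac12)G(m+n+\frac12)$; $[\alpha(m),G(n+\frac12)]=m\,\Psi(m+n+\frac12)$; $[\Psi(m+\frac12),L(n)]=\frac{2m+n+1}{2}\Psi(m+n+\frac12)$; $[\Psi(m+\frac12),G(n+\frac12)]_+=\alpha(m+n+1)+2m\,\delta_{m+n+1,0}C_{L,\alpha}$.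 Let $\mathcal{SH}^{+}$ be the span of $L(n),\alpha(n),G(n-\frac12),\Psi(n-\frac12)$, $n\ge1$. Fix $c_L,c_{L,\alpha}\in\mathbb C$ with $c_{L,\alpha}\ne0$. For $h,h_\alpha\in\mathbb C$, $V(h,h_\alpha)$ denotes the Verma module: the universal $\mathcal{SH}$-module generated by a vector $v$ with $\mathcal{SH}^+v=0$, $L(0)v=hv$, $\alpha(0)v=h_\alpha v$, on which $C_L,C_\alpha,C_{L,\alpha}$ act by $c_L,0,c_{L,\alpha}$. For $p,r\in\mathbb C$ put $h_{p,r}=(1-p^2)\frac{c_L-3}{24}-rp$ and $V[p,r]=V(h_{p,r},(1+p)c_{L,\alpha})$. $V^{\mathcal{SH}}(c_L,c_{L,\alpha})=V(0,0)/\langle G(-\frac12)v\rangle$ is the associated universal vertex superalgebra. Free field realisation: $M(1)$ is the rank two Heisenberg vertex algebra generated by $c(z),d(z)$ associated to the form $\langle c,c\rangle=\langle d,d\rangle=0$, $\langle c,d\rangle=2$. $F^{(2)}$ is the fermionic vertex superalgebra generated by odd fields $\Psi^\pm(z)=\sum_{n\in\mathbb Z}\Psi^\pm(n+\frac12)z^{-n-1}$ with $\{\Psi^\pm(r),\Psi^\pm(s)\}=0$, $\{\Psi^+(r),\Psi^-(s)\}=\delta_{r+s,0}$. Put $\omega_{fer}=\frac12(\Psi^+(-\frac32)\Psi^-(-\frac12)+\Psi^-(-\frac32)\Psi^+(-\frac12)){\bf1}$. In $M(1)\otimes F^{(2)}$ let (applied to the vacuum) $\alpha=-c_{L,\alpha}c(-1)$,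 $\Psi=-\sqrt2\,c_{L,\alpha}\Psi^-(-\frac12)$, $\tau=\sqrt2\left(\frac12c(-1)\Psi^+(-\frac12)+\frac12d(-1)\Psi^-(-\frac12)+\frac{c_L-3}{12}\Psi^-(-\frac32)-\Psi^+(-\frac32)\right)$, $\omega=\frac12c(-1)d(-1)+\frac{c_L-3}{24}c(-2)-\frac12d(-2)+\omega_{fer}$. The components of $Y(\alpha,z)=\sum\alpha(n)z^{-n-1}$, $Y(\Psi,z)=\sum\Psi(n+\frac12)z^{-n-1}$, $Y(\tau,z)=\sum G(n+\frac12)z^{-n-2}$, $Y(\omega,z)=\sum L(n)z^{-n-2}$ make every $M(1)\otimes F^{(2)}$-module into an $\mathcal{SH}$-module (and $V^{\mathcal{SH}}(c_L,c_{L,\alpha})$-module) with central charges $c_L,0,c_{L,\alpha}$. For $\gamma\in\mathbb C c+\mathbb C d$, $e^\gamma$ denotes the highest weight vector of the Heisenberg Fock module on which $c(0),d(0)$ act by $\langle c,\gamma\rangle,\langle d,\gamma\rangle$. Put $\overline d=d-\frac{c_L-3}{12}c$, $v_{p,r}=e^{-\frac{p+1}{2}\overline d+rc}$ (a highest weight vector of weight $(h_{p,r},(1+p)c_{L,\alpha})$) and $\mathcal F_{p,r}=(M(1)\otimes F^{(2)}).v_{p,r}$, the Fock module generated by it. *)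

(* Defs.v *)
From HB Require Import structures.
From mathcomp Require Import all_boot all_order all_algebra.
From mathcomp Require Import all_classical all_reals.
From mathcomp Require Import complex.

Set Implicit Arguments.
Unset Strict Implicit.
Unset Printing Implicit Defensive.

Import Order.TTheory GRing.Theory Num.Theory.
Local Open Scope ring_scope.
Local Open Scope quotient_scope.

(* A Lie superalgebra over K, given by structure constants on a homogeneous
   basis: [sbracket a b] is the superbracket of two basis vectors, as a formal
   linear combination of basis vectors.  Super antisymmetry and the Jacobi
   identity are not recorded: the notion of module only uses the table. *)
Record superlie (K : fieldType) := SuperLie {
  sbasis :> Type;
  sodd : sbasis -> bool;
  sbracket : sbasis -> sbasis -> seq (K * sbasis);
  sbracket_odd : forall a b,
    all (fun t => sodd t.2 == sodd a (+) sodd b) (sbracket a b)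
}.

Section Representations.
Variables (K : fieldType) (g : superlie K).

(* (-1)^(|a||b|) *)
Definition ssign (a b : g) : K := (-1) ^+ (sodd a && sodd b).

(* The Z/2-grading is recorded by the parity involution: [parity] is 1 on the
   even part and -1 on the odd part. *)
Record srep := SRep {
  srep_space :> lmodType K;
  act : g -> srep_space -> srep_space;
  parity : srep_space -> srep_space
}.

Record is_module (M : srep) : Prop := IsModule {
  act_lin : forall b, linear (@act M b);
  parity_lin : linear (@parity M);
  parity_inv : forall x, @parity M (parity x) = x;
  parity_act : forall b x,
    @parity M (act b x) = (-1) ^+ sodd b *: act b (parity x);
  act_bracket : forall a b x,
    @act M a (act b x) - ssign a b *: act b (act a x) =
    \sum_(t <- sbracket a b) t.1 *: act t.2 x
}.

Definition is_hom (M N : srep) (f : {linear M -> N}) : Prop :=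
  (forall b x, f (act b x) = act b (f x)) /\
  (forall x, f (parity x) = parity (f x)).

Definition isomorphic (M N : srep) : Prop :=
  [/\ is_module M, is_module N &
      exists f : {linear M -> N}, is_hom f /\ bijective f].

(* A partial function [hw : g -> option K] prescribes how some basis vectors
   act on a generator; [is_hwv hw w] also fixes [w] to be even. *)
Definition is_hwv (hw : g -> option K) (M : srep) (w : M) : Prop :=
  parity w = w /\ forall b x, hw b = Some x -> act b w = x *: w.

End Representations.

Arguments act {K g s} b x.
Arguments parity {K g s} x.

(* The universal module generated by an even vector on which g acts as
   prescribed by [hw]: terms modulo the congruence generated by the axioms.
   Its universal property is [hwmod_universal] below. *)
Section HighestWeightModule.
Variables (K : fieldType) (g : superlie K) (hw : g -> option K).

Inductive hwterm :=
  | TGen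
  | TZero
  | TAdd of hwterm & hwterm
  | TScale of K & hwterm
  | TAct of g & hwterm.

HB.instance Definition _ := gen_eqMixin hwterm.
HB.instance Definition _ := gen_choiceMixin hwterm.

Definition tlin (s : seq (K * g)) (x : hwterm) : hwterm :=
  foldr (fun t y => TAdd (TScale t.1 (TAct t.2 x)) y) TZero s.

Inductive hweq : hwterm -> hwterm -> Prop :=
  | hweq_refl x : hweq x x
  | hweq_sym x y : hweq x y -> hweq y x
  | hweq_trans y x z : hweq x y -> hweq y z -> hweq x z
  | hweq_add x x' y y' : hweq x x' -> hweq y y' -> hweq (TAdd x y) (TAdd x' y')
  | hweq_scale a x x' : hweq x x' -> hweq (TScale a x) (TScale a x')
  | hweq_act b x x' : hweq x x' -> hweq (TAct b x) (TAct b x')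
  | hweq_addA x y z : hweq (TAdd x (TAdd y z)) (TAdd (TAdd x y) z)
  | hweq_addC x y : hweq (TAdd x y) (TAdd y x)
  | hweq_add0 x : hweq (TAdd TZero x) x
  | hweq_addN x : hweq (TAdd (TScale (-1) x) x) TZero
  | hweq_scaleA a b x : hweq (TScale a (TScale b x)) (TScale (a * b) x)
  | hweq_scale1 x : hweq (TScale 1 x) x
  | hweq_scaleDr a x y :
      hweq (TScale a (TAdd x y)) (TAdd (TScale a x) (TScale a y))
  | hweq_scaleDl x a b :
      hweq (TScale (a + b) x) (TAdd (TScale a x) (TScale b x))
  | hweq_act_lin b a x y :
      hweq (TAct b (TAdd (TScale a x) y)) (TAdd (TScale a (TAct b x)) (TAct b y))
  | hweq_bracket a b x :
      hweq (TAdd (TAct a (TAct b x)) (TScale (- ssign a b) (TAct b (TAct a x))))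
           (tlin (sbracket a b) x)
  | hweq_gen b x : hw b = Some x -> hweq (TAct b TGen) (TScale x TGen).

Definition hweqb (x y : hwterm) : bool := `[< hweq x y >].

Lemma hweqb_refl : reflexive hweqb.
Proof. by move=> x; apply/asboolP; exact: hweq_refl. Qed.

Lemma hweqb_sym : symmetric hweqb.
Proof. by move=> x y; apply/asboolP/asboolP => /hweq_sym. Qed.

Lemma hweqb_trans : transitive hweqb.
Proof.
move=> y x z /asboolP xy /asboolP yz; apply/asboolP; exact: hweq_trans xy yz.
Qed.

Canonical hweqb_equiv := EquivRel hweqb hweqb_refl hweqb_sym hweqb_trans.

Definition hwspace : Type := {eq_quot hweqb}.
HB.instance Definition _ := gen_eqMixin hwspace.
HB.instance Definition _ := gen_choiceMixin hwspace.

Definition hwcls (x : hwterm) : hwspace := \pi_({eq_quot hweqb}) x.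
Definition hwrepr (v : hwspace) : hwterm := repr (v : {eq_quot hweqb}).

Lemma hwreprK (v : hwspace) : hwcls (hwrepr v) = v.
Proof. exact: (@reprK _ {eq_quot hweqb}). Qed.

Lemma hwclsP (x y : hwterm) : hweq x y <-> hwcls x = hwcls y.
Proof.
split=> [xy|]; first by apply/eqmodP/asboolP.
by move/eqmodP/asboolP.
Qed.

Lemma hwrepr_eq (x : hwterm) : hweq (hwrepr (hwcls x)) x.
Proof. by apply/hwclsP; rewrite hwreprK. Qed.

Lemma hwspace_ind (P : hwspace -> Prop) :
  (forall x, P (hwcls x)) -> forall v, P v.
Proof. by move=> Px v; rewrite -(hwreprK v). Qed.

Definition hwadd (u v : hwspace) := hwcls (TAdd (hwrepr u) (hwrepr v)).
Definition hwscale (a : K) (v : hwspace) := hwcls (TScale a (hwrepr v)).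
Definition hwact (b : g) (v : hwspace) := hwcls (TAct b (hwrepr v)).

Lemma hwaddE x y : hwadd (hwcls x) (hwcls y) = hwcls (TAdd x y).
Proof. by apply/hwclsP; apply: hweq_add; exact: hwrepr_eq. Qed.
Lemma hwscaleE a x : hwscale a (hwcls x) = hwcls (TScale a x).
Proof. by apply/hwclsP; apply: hweq_scale; exact: hwrepr_eq. Qed.
Lemma hwactE b x : hwact b (hwcls x) = hwcls (TAct b x).
Proof. by apply/hwclsP; apply: hweq_act; exact: hwrepr_eq. Qed.

Lemma hwaddA : associative hwadd.
Proof.
elim/hwspace_ind=> x; elim/hwspace_ind=> y; elim/hwspace_ind=> z.
by rewrite !hwaddE; apply/hwclsP; exact: hweq_addA.
Qed.
Lemma hwaddC : commutative hwadd.
Proof.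
elim/hwspace_ind=> x; elim/hwspace_ind=> y.
by rewrite !hwaddE; apply/hwclsP; exact: hweq_addC.
Qed.
Lemma hwadd0 : left_id (hwcls TZero) hwadd.
Proof.
by elim/hwspace_ind=> x; rewrite hwaddE; apply/hwclsP; exact: hweq_add0.
Qed.
Lemma hwaddN : left_inverse (hwcls TZero) (hwscale (-1)) hwadd.
Proof.
elim/hwspace_ind=> x; rewrite hwscaleE hwaddE; apply/hwclsP.
exact: hweq_addN.
Qed.

HB.instance Definition _ :=
  GRing.isZmodule.Build hwspace hwaddA hwaddC hwadd0 hwaddN.

Lemma hwscaleA a b v : hwscale a (hwscale b v) = hwscale (a * b) v.
Proof.
elim/hwspace_ind: v => x; rewrite !hwscaleE; apply/hwclsP.
exact: hweq_scaleA.
Qed.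
Lemma hwscale1 : left_id 1 hwscale.
Proof.
by elim/hwspace_ind=> x; rewrite hwscaleE; apply/hwclsP; exact: hweq_scale1.
Qed.
Lemma hwscaleDr : right_distributive hwscale +%R.
Proof.
move=> a; elim/hwspace_ind=> x; elim/hwspace_ind=> y.
rewrite [X in hwscale _ X]hwaddE !hwscaleE [RHS]hwaddE; apply/hwclsP.
exact: hweq_scaleDr.
Qed.
Lemma hwscaleDl v : {morph hwscale^~ v : a b / a + b}.
Proof.
move=> a b; elim/hwspace_ind: v => x.
by rewrite !hwscaleE [RHS]hwaddE; apply/hwclsP; exact: hweq_scaleDl.
Qed.

HB.instance Definition _ := GRing.Zmodule_isLmodule.Build K hwspace
  hwscaleA hwscale1 hwscaleDr hwscaleDl.

Lemma hwclsD x y : hwcls (TAdd x y) = hwcls x + hwcls y.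
Proof. by rewrite -hwaddE. Qed.
Lemma hwclsZ a x : hwcls (TScale a x) = a *: hwcls x.
Proof. by rewrite -hwscaleE. Qed.
Lemma hwcls0 : hwcls TZero = 0. Proof. by []. Qed.

Fixpoint tpar (x : hwterm) : hwterm :=
  match x with
  | TGen => TGen
  | TZero => TZero
  | TAdd y z => TAdd (tpar y) (tpar z)
  | TScale a y => TScale a (tpar y)
  | TAct b y => TScale ((-1) ^+ sodd b) (TAct b (tpar y))
  end.

Definition hwparity (v : hwspace) := hwcls (tpar (hwrepr v)).

Definition hwmod : srep g := SRep hwact hwparity.
Definition hwgen : hwmod := hwcls TGen.

(* An odd basis vector can only kill the even generator. *)
Hypothesis hw_odd : forall b x, hw b = Some x -> sodd b -> x = 0.

Lemma hwcls_tlin s x :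
  hwcls (tlin s x) = \sum_(t <- s) t.1 *: hwcls (TAct t.2 x).
Proof.
elim: s => [|t s IH]; first by rewrite big_nil.
by rewrite big_cons /= hwclsD hwclsZ IH.
Qed.

Lemma hwactD b x y : hwcls (TAct b (TAdd x y)) =
  hwcls (TAct b x) + hwcls (TAct b y).
Proof.
have := hweq_act_lin b 1 x y => /hwclsP; rewrite hwclsD hwclsZ scale1r => <-.
apply/hwclsP/hweq_act/hweq_add; last exact: hweq_refl.
exact/hweq_sym/hweq_scale1.
Qed.

Lemma hwact0 b : hwcls (TAct b TZero) = 0.
Proof.
apply: (addrI (hwcls (TAct b TZero))); rewrite addr0 -hwactD.
by apply/hwclsP/hweq_act/hweq_add0.
Qed.

Lemma hwactZ b a x : hwcls (TAct b (TScale a x)) = a *: hwcls (TAct b x).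
Proof.
have := hweq_act_lin b a x TZero => /hwclsP; rewrite hwclsD hwclsZ hwact0 addr0.
move=> <-; apply/hwclsP/hweq_act/(hweq_trans _ (hweq_addC _ _)).
exact/hweq_sym/hweq_add0.
Qed.

Lemma hwact_congr b x y : hwcls x = hwcls y -> hwcls (TAct b x) = hwcls (TAct b y).
Proof. by move=> /hwclsP xy; apply/hwclsP/hweq_act. Qed.

Lemma tlinE_par s x (e : bool) : all (fun t => sodd t.2 == e) s ->
  hwcls (tpar (tlin s x)) = (-1) ^+ e *: hwcls (tlin s (tpar x)).
Proof.
elim: s => [|t s IH] /=; first by rewrite scaler0.
case/andP=> /eqP te /IH e_s.
by rewrite !hwclsD !hwclsZ e_s te scalerDr !scalerA mulrC.
Qed.

Lemma tpar_eq x y : hweq x y -> hwcls (tpar x) = hwcls (tpar y).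
Proof.
elim=> {x y}
  [x|x y _ ->|x y z _ -> _|x x' y y' _ e1 _ e2|a x x' _ e|b x x' _ e
  |x y z|x y|x|x|a b x|x|a x y|x a b|b a x y|a b x|b x hb] //=;
  rewrite ?hwclsD ?hwclsZ ?hwclsD ?hwclsZ.
- by rewrite e1 e2.
- by rewrite e.
- by congr (_ *: _); apply: hwact_congr.
- by rewrite addrA.
- by rewrite addrC.
- by rewrite add0r.
- by rewrite scaleN1r addNr.
- by rewrite scalerA.
- by rewrite scale1r.
- by rewrite scalerDr.
- by rewrite scalerDl.
- by rewrite hwactD hwactZ scalerDr !scalerA mulrC.
- rewrite !hwactZ (tlinE_par _ (sbracket_odd a b)).
  have /hwclsP := hweq_bracket a b (tpar x); rewrite hwclsD hwclsZ => <-.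
  rewrite scalerDr signr_addb !scalerA; congr (_ + _ *: _).
  by rewrite -mulrA [RHS]mulrC; congr (_ * _); exact: mulrC.
- have /hwclsP -> := hweq_gen hb; rewrite hwclsZ.
  by case: (boolP (sodd b)) => [/(hw_odd hb) ->|_];
    rewrite ?scale1r // !scale0r scaler0.
Qed.

Lemma hwparityE x : hwparity (hwcls x) = hwcls (tpar x).
Proof. exact/tpar_eq/hwrepr_eq. Qed.

Lemma hwmod_is_module : is_module hwmod.
Proof.
split=> /=.
- move=> b a; elim/hwspace_ind=> x; elim/hwspace_ind=> y.
  by rewrite -hwclsZ -hwclsD !hwactE hwactD hwactZ.
- move=> a; elim/hwspace_ind=> x; elim/hwspace_ind=> y.
  by rewrite -hwclsZ -hwclsD !hwparityE /= hwclsD hwclsZ.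
- elim/hwspace_ind=> x; rewrite !hwparityE.
  elim: x => //= [x IHx y IHy|a x IH|b x IH].
  + by rewrite !hwclsD IHx IHy.
  + by rewrite !hwclsZ IH.
  + by rewrite !hwclsZ scalerA -signr_addb addbb scale1r; exact: hwact_congr.
- move=> b; elim/hwspace_ind=> x.
  by rewrite hwactE !hwparityE /= hwactE hwclsZ.
- move=> a b; elim/hwspace_ind=> x.
  have /hwclsP := hweq_bracket a b x; rewrite hwclsD hwclsZ hwcls_tlin.
  rewrite scaleNr !hwactE => ->.
  by apply: eq_bigr => t _; rewrite hwactE.
Qed.

Lemma hwgen_is_hwv : is_hwv hw hwgen.
Proof.
split=> [|b x hb]; first by rewrite /= hwparityE.
by rewrite /= hwactE -hwclsZ; apply/hwclsP/hweq_gen.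
Qed.

Lemma hwmod_universal (M : srep g) (w : M) : is_module M -> is_hwv hw w ->
  exists f : {linear hwmod -> M}, [/\ is_hom f, f hwgen = w &
    forall f' : {linear hwmod -> M}, is_hom f' -> f' hwgen = w -> f' =1 f].
Proof.
move=> HM [wpar whw].
pose ev := fix ev (x : hwterm) : M := match x with
  | TGen => w | TZero => 0 | TAdd y z => ev y + ev z
  | TScale a y => a *: ev y | TAct b y => act b (ev y) end.
have actD b (x y : M) : act b (x + y) = act b x + act b y.
  by rewrite -{1}[x]scale1r (act_lin HM) scale1r.
have act0 b : act b (0 : M) = 0.
  by apply: (addrI (act b (0 : M))); rewrite -actD !addr0.
have actZ b a (x : M) : act b (a *: x) = a *: act b x.
  by rewrite -[a *: x]addr0 (act_lin HM) act0 !addr0.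
have ev_eq x y : hweq x y -> ev x = ev y.
  elim=> {x y}
    [x|x y _ ->|x y z _ -> _|x x' y y' _ e1 _ e2|a x x' _ e|b x x' _ e
    |x y z|x y|x|x|a b x|x|a x y|x a b|b a x y|a b x|b x hb] //=.
  - by rewrite e1 e2.
  - by rewrite e.
  - by rewrite e.
  - by rewrite addrA.
  - by rewrite addrC.
  - by rewrite add0r.
  - by rewrite scaleN1r addNr.
  - by rewrite scalerA.
  - by rewrite scale1r.
  - by rewrite scalerDr.
  - by rewrite scalerDl.
  - by rewrite actD actZ.
  - rewrite scaleNr (act_bracket HM).
    elim: (sbracket a b) => [|t s IH]; first by rewrite big_nil.
    by rewrite big_cons /= IH.
  - exact: whw.
pose f (v : hwmod) : M := ev (hwrepr v).
have fE x : f (hwcls x) = ev x by apply/ev_eq/hwrepr_eq.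
have f_lin : linear f.
  move=> a; elim/hwspace_ind=> x; elim/hwspace_ind=> y.
  by rewrite -hwclsZ -hwclsD !fE.
pose fL := GRing.isLinear.Build K hwmod M *:%R f f_lin.
pose F : {linear hwmod -> M} := HB.pack f fL.
have parD (x y : M) : parity (x + y) = parity x + parity y.
  by rewrite -{1}[x]scale1r (parity_lin HM) scale1r.
have par0 : parity (0 : M) = 0.
  by apply: (addrI (parity (0 : M))); rewrite -parD !addr0.
have parZ a (x : M) : parity (a *: x) = a *: parity x.
  by rewrite -[a *: x]addr0 (parity_lin HM) par0 !addr0.
exists F; split.
- split=> [b|]; elim/hwspace_ind=> x /=; first by rewrite hwactE !fE.
  rewrite hwparityE !fE; elim: x => //= [x IHx y IHy|a x IH|b x IH].
  + by rewrite parD IHx IHy.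
  + by rewrite parZ IH.
  + by rewrite (parity_act HM) IH.
- exact: fE.
- move=> f' [f'act _] f'gen; elim/hwspace_ind; rewrite /= => x; rewrite fE.
  elim: x => [||x IHx y IHy|a x IH|b x IH] //=.
  + exact: linear0.
  + by rewrite hwclsD linearD IHx IHy.
  + by rewrite hwclsZ linearZ IH.
  + by rewrite -hwactE f'act IH.
Qed.

End HighestWeightModule.

Section HeisenbergVirasoro.
Variable K : fieldType.

(* [SG n] and [SPsi n] stand for G(n + 1/2) and Psi(n + 1/2). *)
Inductive sh_basis :=
  | SL of int | Salpha of int | SG of int | SPsi of int
  | SCL | SCalpha | SCLalpha.

Definition sh_odd (b : sh_basis) : bool :=
  match b with SG _ | SPsi _ => true | _ => false end.

Definition kdelta (n : int) : K := (n == 0)%:R.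

Definition sh_table (a b : sh_basis) : option (seq (K * sh_basis)) :=
  match a, b with
  | Salpha m, Salpha n => Some [:: (kdelta (m + n) * m%:~R, SCalpha)]
  | SL m, Salpha n => Some [:: (- n%:~R, Salpha (m + n));
      (- (kdelta (m + n) * (m ^+ 2 + m)%:~R), SCLalpha)]
  | SL m, SL n => Some [:: ((m - n)%:~R, SL (m + n));
      (kdelta (m + n) * ((m ^+ 3 - m)%:~R / 12), SCL)]
  | SPsi m, SPsi n => Some [:: (kdelta (m + n + 1), SCalpha)]
  | Salpha m, SPsi n => Some [::]
  | SG m, SG n => Some [:: (2, SL (m + n + 1));
      (kdelta (m + n + 1) * ((m ^+ 2 + m)%:~R / 3), SCL)]
  | SL m, SG n => Some [:: (m%:~R / 2 - n%:~R - 1 / 2, SG (m + n))]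
  | Salpha m, SG n => Some [:: (m%:~R, SPsi (m + n))]
  | SPsi m, SL n => Some [:: ((2 * m + n + 1)%:~R / 2, SPsi (m + n))]
  | SPsi m, SG n => Some [:: (1, Salpha (m + n + 1));
      (2 * m%:~R * kdelta (m + n + 1), SCLalpha)]
  | _, _ => None
  end.

(* Pairs absent from the table: by super antisymmetry if the reversed pair is
   present; otherwise one entry is central and the bracket is zero. *)
Definition sh_bracket (a b : sh_basis) : seq (K * sh_basis) :=
  match sh_table a b, sh_table b a with
  | Some s, _ => s
  | None, Some s =>
      [seq (- (-1) ^+ (sh_odd a && sh_odd b) * t.1, t.2) | t <- s]
  | None, None => [::]
  end.

Lemma sh_bracket_odd a b :
  all (fun t => sh_odd t.2 == sh_odd a (+) sh_odd b) (sh_bracket a b).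
Proof. by case: a; case: b. Qed.

Definition SH : superlie K := SuperLie sh_bracket_odd.

(* The Verma module V(h, h_alpha) of central charges c_L, 0, c_{L,alpha};
   G(n + 1/2) and Psi(n + 1/2) are positive for n >= 0. *)
Definition verma_hw (cL cLa h ha : K) (b : SH) : option K :=
  match b with
  | SL n => if n > 0 then Some 0 else if n == 0 then Some h else None
  | Salpha n => if n > 0 then Some 0 else if n == 0 then Some ha else None
  | SG n | SPsi n => if n >= 0 then Some 0 else None
  | SCL => Some cL
  | SCalpha => Some 0
  | SCLalpha => Some cLa
  end.

Definition verma (cL cLa h ha : K) : srep SH := hwmod (verma_hw cL cLa h ha).

Lemma verma_hw_odd cL cLa h ha (b : SH) x :
  verma_hw cL cLa h ha b = Some x -> sodd b -> x = 0.
Proof. by case: b => //= n; case: ifP => // _ []. Qed.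

Definition h_pr (cL p r : K) : K := (1 - p ^+ 2) * ((cL - 3) / 24) - r * p.

Definition verma_pr (cL cLa p r : K) : srep SH :=
  verma cL cLa (h_pr cL p r) ((1 + p) * cLa).

End HeisenbergVirasoro.

Section FreeField.
Variable K : numClosedFieldType.

(* The generating fields of M(1) (x) F^(2). *)
Inductive osc := Oc | Od | Opsip | Opsim.

Definition osc_odd (a : osc) : bool :=
  match a with Opsip | Opsim => true | _ => false end.

(* [Osc a n] is the coefficient a_n of z^(-n-1) in a(z); thus
   [Osc Opsip n] is Psi^+(n + 1/2).  [OscK] is central. *)
Inductive osc_basis := Osc of osc & int | OscK.

Definition osc_basis_odd (b : osc_basis) : bool :=
  if b is Osc a _ then osc_odd a else false.

Definition osc_bracket (x y : osc_basis) : seq (K * osc_basis) :=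
  match x, y with
  | Osc Oc m, Osc Od n | Osc Od m, Osc Oc n =>
      [:: (2 * m%:~R * kdelta K (m + n), OscK)]
  | Osc Opsip m, Osc Opsim n | Osc Opsim m, Osc Opsip n =>
      [:: (kdelta K (m + n + 1), OscK)]
  | _, _ => [::]
  end.

Lemma osc_bracket_odd a b :
  all (fun t => osc_basis_odd t.2 == osc_basis_odd a (+) osc_basis_odd b)
    (osc_bracket a b).
Proof. by case: a => [[] ?|]; case: b => [[] ?|]. Qed.

Definition heis_cliff : superlie K := SuperLie osc_bracket_odd.

(* The space C c + C d, in coordinates, with its bilinear form. *)
Definition cd_space : lmodType K := (K^o * K^o)%type.
Definition cd_form (u v : cd_space) : K := 2 * (u.1 * v.2 + u.2 * v.1).
Definition vec_c : cd_space := (1, 0).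
Definition vec_d : cd_space := (0, 1).

(* The M(1) (x) F^(2)-module generated by e^gamma, tensored with the vacuum
   of F^(2), as a module over the Lie superalgebra of modes. *)
Definition fock_hw (gamma : cd_space) (b : heis_cliff) : option K :=
  match b with
  | Osc a n =>
      if n > 0 then Some 0 else if n == 0 then
        match a with
        | Oc => Some (cd_form vec_c gamma)
        | Od => Some (cd_form vec_d gamma)
        | _ => Some 0
        end
      else None
  | OscK => Some 1
  end.

Definition fock (gamma : cd_space) : srep heis_cliff := hwmod (fock_hw gamma).

Lemma fock_hw_odd gamma (b : heis_cliff) x :
  fock_hw gamma b = Some x -> sodd b -> x = 0.
Proof. by case: b => //= -[] n //; do 2?[case: ifP => // _]; case. Qed.

(* The letter (a, k) is the creation operator a_(-k-1), a word is the vector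
   obtained by applying its letters to the vacuum of M(1) (x) F^(2), and a
   state is a linear combination of words. *)
Definition word := seq (osc * nat).
Definition state := seq (K * word).

Definition word_odd (w : word) : bool :=
  foldr (fun l b => osc_odd l.1 (+) b) false w.

(* Coefficient of z^(-n-1) in Y(w, z) on a module: Y(1, z) = Id and
   Y(a_(-k-1) w, z) = (1/k!) :d^k a(z) Y(w, z):, in modes.  The sums over
   [j] are locally finite (a big operator over an infinite set is the sum over
   the support when it is finite). *)
Fixpoint vop_word (M : srep heis_cliff) (w : word) (n : int) (x : M) : M :=
  match w with
  | [::] => if n == -1 then x else 0
  | (a, k) :: w' =>
      \sum_(j \in [set: nat]%classic) 'C(k + j, j)%:R *:
        (act (Osc a (- k%:Z - 1 - j%:Z) : heis_cliff) (vop_word w' (n + j%:Z) x)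
         + (-1) ^+ (k + (osc_odd a && word_odd w'))%N *:
           vop_word w' (n - k%:Z - 1 - j%:Z) (act (Osc a j%:Z : heis_cliff) x))
  end.

Definition vop (M : srep heis_cliff) (s : state) (n : int) (x : M) : M :=
  \sum_(t <- s) t.1 *: vop_word t.2 n x.

(* Letters: c(-n) = (Oc, n - 1) and Psi^+(-n + 1/2) = (Opsip, n - 1), and
   similarly for d and Psi^-. *)
Definition st_alpha (cLa : K) : state := [:: (- cLa, [:: (Oc, 0%N)])].

Definition st_psi (cLa : K) : state := [:: (- (sqrtC 2 * cLa), [:: (Opsim, 0%N)])].

Definition st_tau (cL : K) : state :=
  [:: (sqrtC 2 * (1 / 2), [:: (Oc, 0%N); (Opsip, 0%N)]);
      (sqrtC 2 * (1 / 2), [:: (Od, 0%N); (Opsim, 0%N)]);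
      (sqrtC 2 * ((cL - 3) / 12), [:: (Opsim, 1%N)]);
      (- sqrtC 2, [:: (Opsip, 1%N)])].

Definition st_omega_fer : state :=
  [:: (1 / 2, [:: (Opsip, 1%N); (Opsim, 0%N)]);
      (1 / 2, [:: (Opsim, 1%N); (Opsip, 0%N)])].

Definition st_omega (cL : K) : state :=
  [:: (1 / 2, [:: (Oc, 0%N); (Od, 0%N)]);
      ((cL - 3) / 24, [:: (Oc, 1%N)]);
      (- (1 / 2), [:: (Od, 1%N)])] ++ st_omega_fer.

Definition free_field_act (cL cLa : K) (M : srep heis_cliff)
    (b : SH K) (x : M) : M :=
  match b with
  | SL n => vop (st_omega cL) (n + 1) x
  | Salpha n => vop (st_alpha cLa) n x
  | SG n => vop (st_tau cL) (n + 1) x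
  | SPsi n => vop (st_psi cLa) n x
  | SCL => cL *: x
  | SCalpha => 0
  | SCLalpha => cLa *: x
  end.

Definition free_field (cL cLa : K) (M : srep heis_cliff) : srep (SH K) :=
  SRep (@free_field_act cL cLa M) (@parity _ _ M).

Definition dbar (cL : K) : cd_space := vec_d - ((cL - 3) / 12) *: vec_c.

Definition fock_pr (cL cLa p r : K) : srep (SH K) :=
  free_field cL cLa (fock (- ((p + 1) / 2) *: dbar cL + r *: vec_c)).

End FreeField.

(* Main.v *)
Require Import Defs.
From HB Require Import structures.
From mathcomp Require Import all_boot all_order all_algebra.
From mathcomp Require Import all_classical all_reals.
From mathcomp Require Import complex.
From mathcomp Require Import ring zify.

(** The canonical map from V[p,r] to F_{p,r} is triangular with respect to a
    filtration.  Since c(0) acts on F_{p,r} by -(p+1), the mode L(-n), n >= 1, is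
    -(n+p)/2 d(-n) plus quadratic terms without c(0) and a multiple of c(-n);
    likewise G(-n+1/2) is -(2n-1+p)/sqrt 2 times Psi^+(-n+1/2) plus other terms,
    while alpha and Psi are nonzero multiples of c and Psi^-.  Let d(-n) have
    weight 2n+2, Psi^+(-n+1/2) weight 2n+1, and c(-n), Psi^-(-n+1/2) weight 0:
    all the other terms lower the weight, because shifting the index of d or
    Psi^+ by k costs less than the factor d(-k) or Psi^+(-k) which the
    accompanying annihilation mode removes.  The leading coefficients vanish only
    if p is a negative integer.  Surjectivity follows by induction on the weight.
    For injectivity, V[p,r] is spanned by ordered words in the creation modes,
    and the image of a combination of ordered words has a nonzero coefficient at
    any oscillator word of maximal weight; the coefficients are read off in a
    model of the Fock space on functions of occupation numbers.

    The relations of SH on F_{p,r} are obtained by commuting G(m) and L(m) through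
    normally ordered sums.  The central term comes from {G,G}, where reordering
    finitely many fermions leaves an anomaly; [L,L] then follows from [L,G] and
    2 L(n) = {G(n+1/2), G(-1/2)}. *)

Set Implicit Arguments.
Unset Strict Implicit.
Unset Printing Implicit Defensive.

Import Order.TTheory GRing.Theory Num.Theory.
Local Open Scope ring_scope.

(** * Linear expressions *)

(** Reified linear combinations: [LAtom i] points into a list of vectors, and scalars stay
    unreified. An identity between vectors thus reduces to scalar identities within reach of [ring]
    and [field]. *)
Inductive lexpr (S : Type) :=
  LAtom of nat | LZero | LAdd of lexpr S & lexpr S | LOpp of lexpr S
| LScale of S & lexpr S.
Arguments LZero {S}.
Arguments LAtom {S}.

Section LinearExpressions.
Variables (K : nzRingType) (V : lmodType K).

Fixpoint leval (env : seq V) (e : lexpr K) : V :=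
  match e with
  | LAtom i => env`_i
  | LZero => 0
  | LAdd e1 e2 => leval env e1 + leval env e2
  | LOpp e1 => - leval env e1
  | LScale a e1 => a *: leval env e1
  end.

Fixpoint lcoef (e : lexpr K) (i : nat) : K :=
  match e with
  | LAtom j => if eqn j i then 1 else 0
  | LZero => 0
  | LAdd e1 e2 => lcoef e1 i + lcoef e2 i
  | LOpp e1 => - lcoef e1 i
  | LScale a e1 => a * lcoef e1 i
  end.

Lemma leval_coef env e :
  leval env e = \sum_(i < size env) lcoef e i *: env`_i.
Proof.
elim: e => [j||e1 IH1 e2 IH2|e1 IH|a e1 IH] /=.
- have [jlt|jge] := ltnP j (size env); last first.
    rewrite nth_default // big1 // => i _; case: eqnP => [ji|_].
      by move: (ltn_ord i); rewrite -ji ltnNge jge.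
    by rewrite scale0r.
  rewrite (bigD1 (Ordinal jlt)) //=; case: eqnP => // _.
  rewrite scale1r big1 ?addr0 // => i /eqP ij.
  case: eqnP => [ji|_]; last by rewrite scale0r.
  by case: ij; apply: val_inj.
- by rewrite big1 // => i _; rewrite scale0r.
- by rewrite IH1 IH2 -big_split; apply: eq_bigr => i _; rewrite scalerDl.
- by rewrite IH -sumrN; apply: eq_bigr => i _; rewrite scaleNr.
- by rewrite IH scaler_sumr; apply: eq_bigr => i _; rewrite scalerA.
Qed.

(** Recursive on the number of vectors, so that [cbn] unfolds it into one conjunct per vector. *)
Fixpoint same_coefs (n : nat) (e1 e2 : lexpr K) : Prop :=
  if n is n'.+1 then lcoef e1 n' = lcoef e2 n' /\ same_coefs n' e1 e2 else True.

Lemma leval_eq env e1 e2 :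
  same_coefs (size env) e1 e2 -> leval env e1 = leval env e2.
Proof.
move=> e12; rewrite !leval_coef; apply: eq_bigr => i _; congr (_ *: _).
elim: (size env) e12 i => [|n IH] /= e12 i; first by case: i.
case: e12 => en /IH {}IH.
have [->//|ni] := eqVneq (i : nat) n.
have ilt : (i < n)%N by rewrite ltn_neqAle ni -ltnS ltn_ord.
exact: (IH (Ordinal ilt)).
Qed.

End LinearExpressions.

Ltac lmod_same x y :=
  match constr:(tt) with
  | _ => let _ := constr:(erefl x : x = y) in constr:(true)
  | _ => constr:(false)
  end.

Ltac lmod_index x l :=
  lazymatch l with
  | nil => constr:(@None nat)
  | cons ?y ?l' =>
      lazymatch lmod_same x y with
      | true => constr:(Some 0%N)
      | false => lazymatch lmod_index x l' with
          | Some ?i => constr:(Some (S i)) | None => constr:(@None nat) end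
      end
  end.

Ltac lmod_atoms l t :=
  lazymatch t with
  | GRing.zero => l
  | GRing.add ?a ?b => let l := lmod_atoms l a in lmod_atoms l b
  | GRing.opp ?a => lmod_atoms l a
  | GRing.scale _ ?a => lmod_atoms l a
  | _ => lazymatch lmod_index t l with Some _ => l | None => constr:(cons t l) end
  end.

Ltac lmod_quote K l t :=
  lazymatch t with
  | GRing.zero => constr:(@LZero K)
  | GRing.add ?a ?b =>
      let x := lmod_quote K l a in let y := lmod_quote K l b in
      constr:(@LAdd K x y)
  | GRing.opp ?a => let x := lmod_quote K l a in constr:(@LOpp K x)
  | GRing.scale ?c ?a => let x := lmod_quote K l a in constr:(@LScale K c x)
  | _ => lazymatch lmod_index t l with Some ?i => constr:(@LAtom K i) end
  end.

Ltac lmod_scalars t :=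
  lazymatch t with
  | GRing.add ?a ?b => match constr:(tt) with
      | _ => lmod_scalars a | _ => lmod_scalars b end
  | GRing.opp ?a => lmod_scalars a
  | GRing.scale ?c _ => type of c
  end.

(* One goal per vector of the linear combinations.  Vectors are identified up to
   conversion, because they may differ in the paths of canonical structures. *)
Ltac lmod_split :=
  lazymatch goal with
  | |- @eq ?V ?x ?y =>
    let l := lmod_atoms (@nil V) x in
    let l := lmod_atoms l y in
    let K := lmod_scalars constr:(x + y) in
    let ex := lmod_quote K l x in
    let ey := lmod_quote K l y in
    refine (@leval_eq _ _ l ex ey _);
    cbn [same_coefs size lcoef eqn]; repeat split
  end.

(** * Free fields *)

Section IntegerSums.
Variable V : zmodType.
Implicit Types F G : int -> V.

Definition vanishes_beyond F (T : nat) := forall i, (T <= absz i)%N -> F i = 0.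
Definition fin_supp F := exists T, vanishes_beyond F T.
Definition zsum F : V := \sum_(i \in [set: int]%classic) F i.

Definition window (T : nat) : seq int :=
  [seq j%:Z - T%:Z | j <- iota 0 T.*2.+1].

Lemma mem_window T i : (absz i <= T)%N -> i \in window T.
Proof.
move=> iT; apply/mapP; exists (absz (i + T%:Z)); last by lia.
by rewrite mem_iota; lia.
Qed.

Lemma window_uniq T : uniq (window T).
Proof. by rewrite map_inj_uniq ?iota_uniq // => x y; lia. Qed.

Lemma zsumE F T : vanishes_beyond F T -> zsum F = \sum_(i <- window T) F i.
Proof.
move=> FT; rewrite bigfs.
- by apply: eq_fsbigl; apply/seteqP; split.
- exact: window_uniq.
- by move=> i _ iT; apply: FT; apply: contraNT iT => iT; apply: mem_window; lia.
Qed.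

Lemma vanishes_le F T T' :
  (T <= T')%N -> vanishes_beyond F T -> vanishes_beyond F T'.
Proof. by move=> TT' FT i iT'; apply/FT/(leq_trans TT'). Qed.

Lemma eq_zsum F G : F =1 G -> zsum F = zsum G.
Proof. by move=> FG; apply: eq_fsbigr => i _; exact: FG. Qed.

Lemma eq_fin_supp F G : F =1 G -> fin_supp F -> fin_supp G.
Proof. by move=> FG [T FT]; exists T => i iT; rewrite -FG FT. Qed.

Lemma fin_suppD F G : fin_supp F -> fin_supp G -> fin_supp (fun i => F i + G i).
Proof.
move=> [T FT] [T' GT]; exists (maxn T T') => i; rewrite geq_max => /andP[iT iT'].
by rewrite FT ?GT ?addr0.
Qed.

Lemma zsumD F G : fin_supp F -> fin_supp G ->
  zsum (fun i => F i + G i) = zsum F + zsum G.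
Proof.
move=> [T FT] [T' GT].
have FT2 := vanishes_le (leq_maxl T T') FT.
have GT2 := vanishes_le (leq_maxr T T') GT.
rewrite (zsumE FT2) (zsumE GT2) -big_split; apply: zsumE => i iT.
by rewrite FT2 ?GT2 ?addr0.
Qed.

Lemma zsum1 F i0 : (forall i, i != i0 -> F i = 0) -> zsum F = F i0.
Proof.
move=> F0; have FT : vanishes_beyond F (absz i0).+1.
  by move=> i ii0; apply: F0; apply/eqP => e; move: ii0; rewrite e ltnn.
rewrite (zsumE FT) (bigD1_seq i0) ?mem_window ?window_uniq //=.
by rewrite big1 ?addr0 // => i /F0.
Qed.

Lemma fin_supp_shift F (s : int) : fin_supp F -> fin_supp (fun i => F (i + s)).
Proof. by move=> [T FT]; exists (T + absz s)%N => i iT; apply: FT; lia. Qed.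

Lemma zsum_bij F (h h' : int -> int) : cancel h h' -> cancel h' h ->
  zsum F = zsum (F \o h).
Proof.
move=> hK h'K; rewrite /zsum (@reindex_fsbigT _ _ _ int int h) //.
by exists h'.
Qed.

Lemma zsum_shift F (s : int) : zsum F = zsum (fun i => F (i + s)).
Proof.
by apply: (zsum_bij _ (h' := fun i => i - s)) => i /=; lia.
Qed.

Lemma zsum_rev F (s : int) : zsum F = zsum (fun i => F (s - i)).
Proof.
by apply: (zsum_bij _ (h' := fun i => s - i)) => i /=; lia.
Qed.

(** Pairing -1 - j with j folds the window onto the natural numbers, over which [vop_word] sums; the
    endpoint T stays unpaired. *)
Lemma sum_window F T : \sum_(i <- window T) F i =
  \sum_(j < T) (F (- 1 - j%:Z) + F j%:Z) + F T%:Z.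
Proof.
have -> n : \sum_(i <- window n) F i = \sum_(j < n.*2.+1) F (j%:Z - n%:Z).
  by rewrite -(big_mkord xpredT (fun j => F (j%:Z - n%:Z))) /index_iota subn0 big_map.
elim: T => [|T IH]; first by rewrite double0 big_ord1 big_ord0 subrr add0r.
rewrite doubleS big_ord_recl big_ord_recr [in RHS]big_ord_recr /= -!addrA.
rewrite [RHS]addrCA; congr (_ + _); first by congr F; lia.
rewrite !addrA; congr (_ + _); last by congr F; rewrite /bump /=; lia.
by rewrite -IH; apply: eq_bigr => j _; congr F; rewrite /bump /=; lia.
Qed.

Lemma zsum_nat F : fin_supp F ->
  \sum_(j \in [set: nat]%classic) (F (- 1 - j%:Z) + F j%:Z) = zsum F.
Proof.
move=> [T FT]; rewrite (zsumE FT) sum_window FT ?addr0 //.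
rewrite (_ : [set: nat]%classic = [set` predT]%classic); last first.
  by apply/seteqP; split.
rewrite -(@bigfs _ _ _ _ (iota 0 T)) ?iota_uniq //; last first.
  by move=> j _; rewrite mem_iota => jT; rewrite !FT ?addr0 //; lia.
by rewrite -(big_mkord xpredT (fun j => F (- 1 - j%:Z) + F j%:Z)) /index_iota subn0.
Qed.

End IntegerSums.

(** * Maps whose linearity is a hypothesis *)

Section LinearMaps.
Variables (K : nzRingType) (V W : lmodType K) (u : V -> W).
Hypothesis u_lin : linear u.

Lemma linD x y : u (x + y) = u x + u y.
Proof. by rewrite -{1}[x]scale1r u_lin scale1r. Qed.

Lemma lin0 : u 0 = 0.
Proof. by apply: (addrI (u 0)); rewrite -linD !addr0. Qed.

Lemma linZ a x : u (a *: x) = a *: u x.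
Proof. by rewrite -[a *: x]addr0 u_lin lin0 addr0. Qed.

Lemma linN x : u (- x) = - u x.
Proof. by rewrite -scaleN1r linZ scaleN1r. Qed.

Lemma lin_sum (I : Type) (r : seq I) (P : pred I) (F : I -> V) :
  u (\sum_(i <- r | P i) F i) = \sum_(i <- r | P i) u (F i).
Proof. exact: (big_morph u linD lin0). Qed.

Lemma fin_supp_lin (F : int -> V) : fin_supp F -> fin_supp (fun i => u (F i)).
Proof. by move=> [T FT]; exists T => i iT; rewrite FT ?lin0. Qed.

Lemma zsum_lin (F : int -> V) :
  fin_supp F -> u (zsum F) = zsum (fun i => u (F i)).
Proof.
move=> [T FT]; rewrite (zsumE FT) lin_sum; apply/esym/zsumE => i iT.
by rewrite FT ?lin0.
Qed.

End LinearMaps.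

Lemma zsumZ (K : comNzRingType) (V : lmodType K) (a : K) (F : int -> V) :
  fin_supp F -> zsum (fun i => a *: F i) = a *: zsum F.
Proof.
move=> Fs; rewrite (@zsum_lin _ _ _ (fun x => a *: x)) //.
by move=> b x y; rewrite scalerDr !scalerA mulrC.
Qed.

Lemma fin_suppZ (K : nzRingType) (V : lmodType K) (a : K) (F : int -> V) :
  fin_supp F -> fin_supp (fun i => a *: F i).
Proof. by move=> [T FT]; exists T => i iT; rewrite FT ?scaler0. Qed.

(** * Oscillator modes and normally ordered quadratic sums *)

Section Oscillators.
Variables (K : numClosedFieldType) (M : srep (heis_cliff K)).

Definition mode (a : osc) (n : int) (x : M) : M := act (Osc a n : heis_cliff K) x.

Definition osign (a b : osc) : K := (-1) ^+ (osc_odd a && osc_odd b).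

Definition obracket (a b : osc) (m n : int) : K :=
  match a, b with
  | Oc, Od | Od, Oc => 2 * m%:~R * kdelta K (m + n)
  | Opsip, Opsim | Opsim, Opsip => kdelta K (m + n + 1)
  | _, _ => 0
  end.

(* The product a(i) b(j), with a(i) moved to the right when [i >= s]; [s = 0] is
   the normal ordering. *)
Definition nop (s : int) (a b : osc) (i j : int) (x : M) : M :=
  if i < s then mode a i (mode b j x) else osign a b *: mode b j (mode a i x).

Definition quad (s : int) (a b : osc) (f : int -> K) (N : int) (x : M) : M :=
  zsum (fun i => f i *: nop s a b i (N - i) x).

(** Local finiteness: it makes the sums [quad] finitely supported on each vector. *)
Definition smooth := forall x : M, exists T : nat,
  forall a (n : int), T%:Z <= n -> mode a n x = 0.

Hypotheses (M_mod : is_module M)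
  (M_level : forall x : M, act (OscK : heis_cliff K) x = x) (M_smooth : smooth).

Lemma mode_lin a n : linear (mode a n). Proof. exact: act_lin. Qed.

Lemma osignC a b : osign a b = osign b a.
Proof. by rewrite /osign andbC. Qed.

Lemma osignK a b : osign a b * osign a b = 1.
Proof. by rewrite /osign -signr_addb addbb. Qed.

Lemma mode_comm a b m n x : mode a m (mode b n x) =
  osign a b *: mode b n (mode a m x) + obracket a b m n *: x.
Proof.
apply/eqP; rewrite addrC -subr_eq; apply/eqP.
rewrite [LHS](act_bracket M_mod (Osc a m : heis_cliff K) (Osc b n)) /=.
by case: a; case: b; rewrite /= ?big_nil ?scale0r // big_seq1 /= M_level.
Qed.

Lemma nop_lin s a b i j : linear (nop s a b i j).
Proof.
move=> c x y; rewrite /nop; case: ifP => _.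
  by rewrite !mode_lin.
by rewrite !mode_lin scalerDr !scalerA mulrC.
Qed.

(** The factor applied first has the large index: b(N - i) when i lies far below s, a(i) when i lies
    far above. *)
Lemma nop_fin_supp s a b (f : int -> K) N x :
  fin_supp (fun i => f i *: nop s a b i (N - i) x).
Proof.
have [T HT] := M_smooth x; exists (T + absz s + absz N).+1 => i iT.
rewrite /nop; case: ifP => is_.
  by rewrite (HT b) ?(lin0 (mode_lin _ _)) ?scaler0 //; lia.
by rewrite (HT a) ?(lin0 (mode_lin _ _)) ?scaler0 //; lia.
Qed.

Lemma quad_lin s a b f N : linear (quad s a b f N).
Proof.
move=> c x y; rewrite /quad -zsumZ; last exact: nop_fin_supp.
rewrite -zsumD; first last.
- exact: nop_fin_supp.
- by apply: fin_supp_lin (nop_fin_supp _ _ _ _ _ _) => d u v;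
    rewrite scalerDr !scalerA mulrC.
by apply: eq_zsum => i; rewrite nop_lin scalerDr !scalerA mulrC.
Qed.

Lemma quadD s a b f g N x :
  quad s a b (fun i => f i + g i) N x = quad s a b f N x + quad s a b g N x.
Proof.
rewrite -zsumD; [|exact: nop_fin_supp..].
by apply: eq_zsum => i; rewrite scalerDl.
Qed.

Lemma quadZ s a b c f N x :
  quad s a b (fun i => c * f i) N x = c *: quad s a b f N x.
Proof.
rewrite -zsumZ; last exact: nop_fin_supp.
by apply: eq_zsum => i; rewrite scalerA.
Qed.

Lemma eq_quad s a b f g N x : f =1 g -> quad s a b f N x = quad s a b g N x.
Proof. by move=> fg; apply: eq_zsum => i; rewrite fg. Qed.

Lemma kdelta0 n : n != 0 -> kdelta K n = 0.
Proof. by rewrite /kdelta => /negPf ->. Qed.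

Lemma kdeltaM n (c d : K) : (n = 0 -> c = d) -> c * kdelta K n = d * kdelta K n.
Proof. by rewrite /kdelta; case: eqP => [_ ->|_ _] //; rewrite !mulr0. Qed.

(** For fermions i + j + 1 = 0 puts i and j on opposite sides of 0; for bosons i + j = 0 does so
    unless i = j = 0, where the factor i vanishes. *)
Lemma obracket_same_side a b i j : (i < 0) = (j < 0) -> obracket a b i j = 0.
Proof.
move=> ij; have ferm : kdelta K (i + j + 1) = 0 by apply: kdelta0; lia.
have bos : 2 * i%:~R * kdelta K (i + j) = 0.
  by rewrite (kdeltaM (d := 0)) ?mul0r // => ij0; have -> : i = 0; [lia | ring].
by case: a; case: b.
Qed.

Lemma nop_flip a b i j x : nop 0 a b i j x = osign a b *: nop 0 b a j i x.
Proof.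
rewrite /nop (osignC b a).
have [i0|i0] := ltrP i 0; have [j0|j0] := ltrP j 0;
  rewrite ?scalerA ?osignK ?scale1r //.
- by rewrite mode_comm obracket_same_side ?scale0r ?addr0 //; lia.
- rewrite [in RHS]mode_comm obracket_same_side ?scale0r ?addr0 1?(osignC b a) //.
  by lia.
Qed.

Lemma quad_flip a b f N x :
  quad 0 a b f N x = osign a b *: quad 0 b a (fun i => f (N - i)) N x.
Proof.
rewrite [in RHS]/quad -zsumZ; last exact: nop_fin_supp.
rewrite (zsum_rev _ N); apply: eq_zsum => i.
have -> : N - (N - i) = i by lia.
by rewrite nop_flip !scalerA mulrC.
Qed.

(* Moving the threshold from [s] to [s + 1] reorders a single product. *)
Lemma quad_threshold a b f N x (h : int -> K) s : h 0 = 0 ->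
    (forall t, h (t + 1) - h t = f t * obracket a b t (N - t)) ->
  quad s a b f N x = quad 0 a b f N x + h s *: x.
Proof.
move=> h0 hS.
have step t : quad (t + 1) a b f N x = quad t a b f N x + (h (t + 1) - h t) *: x.
  rewrite hS /quad; apply/eqP; rewrite [X in _ == X]addrC -subr_eq; apply/eqP.
  rewrite -scaleN1r -zsumZ -?zsumD; try exact: nop_fin_supp; last first.
    by apply: fin_supp_lin (nop_fin_supp _ _ _ _ _ _) => d u v;
      rewrite scalerDr !scalerA mulrC.
  rewrite (zsum1 (i0 := t)) => [|i it].
    by rewrite /nop ltrDl ltr01 ltxx mode_comm -scalerA; lmod_split; ring.
  rewrite /nop; have -> : (i < t + 1) = (i < t) by lia.
  by rewrite scaleN1r subrr.
elim/int_ind: s => [|n IH|n IH]; first by rewrite h0 scale0r addr0.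
- have -> : n.+1%:Z = n%:Z + 1 by lia.
  by rewrite step IH -addrA -scalerDl; congr (_ + _ *: _); ring.
- have := step (- n.+1%:Z); have -> : - n.+1%:Z + 1 = - n%:Z by lia.
  rewrite IH => /eqP; rewrite -subr_eq => /eqP <-.
  by rewrite -addrA -scaleNr -scalerDl; congr (_ + _ *: _); ring.
Qed.

Definition opaired (a b : osc) : bool :=
  match a, b with
  | Oc, Od | Od, Oc | Opsip, Opsim | Opsim, Opsip => true
  | _, _ => false
  end.

(** Fermionic indices are half-integers lowered by 1/2, so paired fermionic modes have indices
    summing to -1 instead of 0. *)
Definition oshift (a : osc) : int := (osc_odd a)%:Z.
Definition ocoef (a : osc) (i : int) : K := if osc_odd a then 1 else 2 * i%:~R.

Lemma obracketE a b i n :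
  obracket a b i n = (opaired a b)%:R * ocoef b i * kdelta K (i + n + oshift b).
Proof.
by case: a; case: b; rewrite /= /ocoef /= /oshift /= ?mul0r ?mul1r ?addr0.
Qed.

(* Keeps the comparison of vectors in [lmod_split] cheap. *)

Opaque mode quad.

Lemma nop_mode s a b e i j n x : nop s a b i j (mode e n x) =
  (osign a e * osign b e) *: mode e n (nop s a b i j x)
  + (osign a b * obracket a e i n) *: mode b j x
  + obracket b e j n *: mode a i x.
Proof.
(* A bracket vanishes unless its two fields have equal parity, so the signs multiplying it may be
   exchanged. *)
have ab : osign b e * obracket a e i n = osign a b * obracket a e i n.
  by case: a; case: b; case: e; rewrite /= ?mulr0.
have ba : osign a b * osign a e * obracket b e j n = obracket b e j n.
  by clear ab; case: a; case: b; case: e; rewrite /osign /= ?mulr0 // ?mulrNN ?mul1r.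
rewrite /nop; case: ifP => _.
  rewrite (mode_comm b e) (linD (mode_lin _ _)) !(linZ (mode_lin _ _)).
  by rewrite (mode_comm a e) -ab; lmod_split; ring.
rewrite (mode_comm a e) (linD (mode_lin _ _)) !(linZ (mode_lin _ _)).
by rewrite (mode_comm b e) -[in RHS]ba; lmod_split; ring.
Qed.

Opaque nop.

Lemma zsum_kdelta (f : int -> K) (F : int -> M) (s : int) :
  zsum (fun i => (f i * kdelta K (i + s)) *: F i) = f (- s) *: F (- s).
Proof.
rewrite (zsum1 (i0 := - s)) => [|i is_]; first by rewrite addNr /kdelta eqxx mulr1.
by rewrite kdelta0 ?mulr0 ?scale0r // addr_eq0.
Qed.

Lemma fin_supp_kdelta (f : int -> K) (F : int -> M) (s : int) :
  fin_supp (fun i => (f i * kdelta K (i + s)) *: F i).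
Proof.
exists (absz s).+1 => i is_; rewrite kdelta0 ?mulr0 ?scale0r //; lia.
Qed.

(** Each of the two brackets with e(n) is nonzero for at most one summand, so it contributes a
    single mode; [ia] is the index of the mode paired with e(n). *)
Lemma quad_mode a b e f N n x (ia := - n - oshift e) :
  quad 0 a b f N (mode e n x) =
  (osign a e * osign b e) *: mode e n (quad 0 a b f N x)
  + (osign a b * (opaired a e)%:R * f ia * ocoef e ia) *: mode b (N - ia) x
  + ((opaired b e)%:R * f (N - ia) * ocoef e ia) *: mode a (N - ia) x.
Proof.
have iaE : n + oshift e = - ia by rewrite /ia; lia.
clearbody ia; have Fs := nop_fin_supp 0 a b f N x.
pose g i := osign a b * (opaired a e)%:R * f i * ocoef e i.
pose h i := (opaired b e)%:R * f i * ocoef e (N - i).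
rewrite (zsum_lin (mode_lin e n) Fs) -zsumZ; last first.
  exact: fin_supp_lin (mode_lin _ _) _ Fs.
have -> : (osign a b * (opaired a e)%:R * f ia * ocoef e ia) *: mode b (N - ia) x =
    zsum (fun i => (g i * kdelta K (i + - ia)) *: mode b (N - i) x).
  by rewrite zsum_kdelta opprK.
have -> : ((opaired b e)%:R * f (N - ia) * ocoef e ia) *: mode a (N - ia) x =
    zsum (fun i => (h i * kdelta K (i + (ia - N))) *: mode a i x).
  by rewrite zsum_kdelta opprB /h; have -> : N - (N - ia) = ia by lia.
have Fs' : fin_supp (fun i => (osign a e * osign b e) *:
    mode e n (f i *: nop 0 a b i (N - i) x)).
  have [T FT] := fin_supp_lin (mode_lin e n) Fs.
  by exists T => i iT; rewrite FT ?scaler0.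
rewrite -!zsumD; try by repeat (first [exact: Fs' | exact: fin_supp_kdelta
  | apply: fin_suppD]).
apply: eq_zsum => i; rewrite nop_mode !obracketE (linZ (mode_lin e n)) /g /h.
have -> : kdelta K (i + n + oshift e) = kdelta K (i + - ia) by congr kdelta; lia.
have -> : kdelta K (N - i + n + oshift e) = kdelta K (i + (ia - N)).
  by rewrite /kdelta; congr (_%:R); congr nat_of_bool; apply/eqP/eqP; lia.
by lmod_split; ring.
Qed.

Lemma osign_even a b : osc_odd a = false -> osign a b = 1.
Proof. by rewrite /osign => ->. Qed.

Transparent nop quad.

(* A superderivation [D] of parity [e] applied to a normally ordered sum of
   products of a boson and a fermion; the threshold of the second sum records
   that the order is still decided by the index of [a]. *)
Lemma quad_deriv (D : M -> M) (e : bool) a a' b b' (m m' : int)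
    (u v : int -> K) (u0 v0 : K) N x :
    linear D -> osc_odd a = false -> osc_odd b -> osc_odd a' = e ->
    (e -> u0 = 0) ->
    (forall i y, D (mode a i y) = mode a i (D y) +
      u i *: mode a' (i + m) y + (u0 * kdelta K (i + m)) *: y) ->
    (forall j y, D (mode b j y) = (-1) ^+ e *: mode b j (D y) +
      v j *: mode b' (j + m') y + (v0 * kdelta K (j + m')) *: y) ->
  D (quad 0 a b (fun=> 1) N x) = (-1) ^+ e *: quad 0 a b (fun=> 1) N (D x)
    + quad m a' b (fun i => u (i - m)) (N + m) x
    + quad 0 a b' (fun i => v (N - i)) (N + m') x
    + u0 *: mode b (N + m) x + v0 *: mode a (N + m') x.
Proof.
move=> D_lin a0 b1 a'e u0e Da Db.
have modeD c n := linD (mode_lin c n); have modeZ c n := linZ (mode_lin c n).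
have nopD i j : D (nop 0 a b i j x) = (-1) ^+ e *: nop 0 a b i j (D x)
    + u i *: nop m a' b (i + m) j x + v j *: nop 0 a b' i (j + m') x
    + (u0 * kdelta K (i + m)) *: mode b j x
    + (v0 * kdelta K (j + m')) *: mode a i x.
  (* Since [u0] = 0 for odd D, the sign picked up when D crosses b may be inserted or dropped in the
     scalar term. *)
  have -> : u0 * kdelta K (i + m) = (-1) ^+ e * (u0 * kdelta K (i + m)).
    by move: u0e; case: e {Db a'e} => [->|] //; rewrite ?mul0r ?mulr0 ?mul1r.
  rewrite /nop !(osign_even _ a0); have -> : (i + m < m) = (i < 0) by lia.
  have -> : osign a' b = (-1) ^+ e by rewrite /osign a'e b1 andbT.
  case: ifP => _.
    rewrite Da Db !modeD !modeZ.
    have -> : (-1) ^+ e * (u0 * kdelta K (i + m)) = u0 * kdelta K (i + m).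
      by move: u0e; case: e {Db a'e} => [->|] //; rewrite ?mul0r ?mulr0 ?mul1r.
    by lmod_split; ring.
  by rewrite (linZ D_lin) Db Da !modeD !modeZ; lmod_split; ring.
have Fs := nop_fin_supp.
rewrite /quad (zsum_lin D_lin (Fs _ _ _ _ _ _)) -zsumZ //.
rewrite [X in _ + X + _ + _ + _](zsum_shift _ m).
have -> : u0 *: mode b (N + m) x =
    zsum (fun i => (u0 * kdelta K (i + m)) *: mode b (N - i) x).
  by rewrite zsum_kdelta opprK.
have -> : v0 *: mode a (N + m') x =
    zsum (fun i => (v0 * kdelta K (i + - (N + m'))) *: mode a i x).
  by rewrite zsum_kdelta opprK.
rewrite -!zsumD; try by repeat (first [exact: Fs | exact: fin_supp_kdelta
  | exact: (fin_supp_shift m (Fs m a' b (fun i => u (i - m)) (N + m) x))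
  | apply: fin_suppD | apply: fin_suppZ]).
apply: eq_zsum => i; rewrite (linZ D_lin) nopD addrK.
have -> : N + m - (i + m) = N - i by lia.
have -> : N - i + m' = N + m' - i by lia.
have -> : kdelta K (N + m' - i) = kdelta K (i - (N + m')).
  by rewrite /kdelta; congr (_%:R); congr nat_of_bool; apply/eqP/eqP; lia.
by lmod_split; ring.
Qed.

Opaque nop quad.

(** * The operators G(m + 1/2) and L(m) and their relations *)

Variable cL : K.
Let A : K := (cL - 3) / 12.
Let q : K := sqrtC 2.

(** [Gop m] is the component G(m + 1/2) of the field of τ, and [Lop m] below is L(m), in closed
    form; the factors m + 1 come from the derivatives of fields. *)
Definition Gop (m : int) (x : M) : M :=
  q *: ((1 / 2) *: quad 0 Oc Opsip (fun=> 1) m x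
    + (1 / 2) *: quad 0 Od Opsim (fun=> 1) m x
    - (A * (m + 1)%:~R) *: mode Opsim m x + (m + 1)%:~R *: mode Opsip m x).

Definition Lop (m : int) (x : M) : M :=
  (1 / 2) *: quad 0 Oc Od (fun=> 1) m x
  + ((m + 1)%:~R / 2) *: (mode Od m x - A *: mode Oc m x)
  + (1 / 2) *: (quad 0 Opsip Opsim (fun i => - i%:~R - 1) (m - 1) x
                + quad 0 Opsim Opsip (fun i => - i%:~R - 1) (m - 1) x).

Lemma qq : q * q = 2. Proof. by rewrite -expr2 sqrtCK. Qed.

Lemma Gop_lin m : linear (Gop m).
Proof.
move=> c x y; rewrite /Gop !(quad_lin _ _ _ _ _ c) !(mode_lin _ _ c).
by lmod_split; ring.
Qed.

Lemma Lop_lin m : linear (Lop m).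
Proof.
move=> c x y; rewrite /Lop !(quad_lin _ _ _ _ _ c) !(mode_lin _ _ c).
by lmod_split; ring.
Qed.

Lemma modeE a n : (forall c x, mode a n (c *: x) = c *: mode a n x) *
  (forall x y, mode a n (x + y) = mode a n x + mode a n y) *
  (forall x, mode a n (- x) = - mode a n x).
Proof.
by split; first split; [exact: linZ (mode_lin _ _)|exact: linD (mode_lin _ _)
  |exact: linN (mode_lin _ _)].
Qed.

(** This and the next three lemmas are the supersymmetry on generators: G(m + 1/2) exchanges c with
    Psi^- and d with Psi^+, and the background charges give the scalar terms in the fermionic
    relations. *)
Lemma Gop_c m n x : Gop m (mode Oc n x) =
  mode Oc n (Gop m x) + (- (q * n%:~R)) *: mode Opsim (n + m) x.
Proof.
rewrite /Gop !quad_mode (mode_comm Opsim Oc m) (mode_comm Opsip Oc m) !modeE.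
rewrite /osign /ocoef /= /oshift /=.
have -> : - n - 0 = - n by lia.
have -> : m - - n = n + m by lia.
by lmod_split; field.
Qed.

Lemma Gop_d m n x : Gop m (mode Od n x) =
  mode Od n (Gop m x) + (- (q * n%:~R)) *: mode Opsip (n + m) x.
Proof.
rewrite /Gop !quad_mode (mode_comm Opsim Od m) (mode_comm Opsip Od m) !modeE.
rewrite /osign /ocoef /= /oshift /=.
have -> : - n - 0 = - n by lia.
have -> : m - - n = n + m by lia.
by lmod_split; field.
Qed.

Lemma Gop_psim m n x : Gop m (mode Opsim n x) =
  (-1) *: mode Opsim n (Gop m x) + (q / 2) *: mode Oc (n + (m + 1)) x
  + (q * (m + 1)%:~R * kdelta K (n + (m + 1))) *: x.
Proof.
rewrite /Gop !quad_mode (mode_comm Opsim Opsim m) (mode_comm Opsip Opsim m) !modeE.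
rewrite /osign /ocoef /= /oshift /=.
have -> : m - (- n - 1) = n + (m + 1) by lia.
have -> : kdelta K (m + n + 1) = kdelta K (n + (m + 1)) by congr kdelta; lia.
by lmod_split; field.
Qed.

Lemma Gop_psip m n x : Gop m (mode Opsip n x) =
  (-1) *: mode Opsip n (Gop m x) + (q / 2) *: mode Od (n + (m + 1)) x
  + (- (q * A * (m + 1)%:~R) * kdelta K (n + (m + 1))) *: x.
Proof.
rewrite /Gop !quad_mode (mode_comm Opsim Opsip m) (mode_comm Opsip Opsip m) !modeE.
rewrite /osign /ocoef /= /oshift /=.
have -> : m - (- n - 1) = n + (m + 1) by lia.
have -> : kdelta K (m + n + 1) = kdelta K (n + (m + 1)) by congr kdelta; lia.
by lmod_split; field.
Qed.

(** The functions -i - 1, as in the fermionic part of L(m), and 1 span the affine functions of i. *)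
Lemma quad_affine (a b : osc) (c d : K) (s N : int) x :
  quad s a b (fun i => c * i%:~R + d) N x =
  (- c) *: quad s a b (fun i => - i%:~R - 1) N x
  + (d - c) *: quad s a b (fun=> 1) N x.
Proof.
rewrite -!quadZ -quadD; apply: eq_quad => i; ring.
Qed.

(** The anomaly behind the central charge: for s > 0, restoring the threshold 0 reorders the
    products with 0 <= i < s, and c (i - s) sums over these i to -c (s^2 + s)/2. The discrete
    primitive [h] covers both signs of s. *)
Lemma quad_thresholdE (a b : osc) (c : K) (s N : int) x :
    osc_odd a -> osc_odd b ->
  quad s a b (fun i => c * (i - s)%:~R) N x =
  quad 0 a b (fun i => c * (i - s)%:~R) N x
   - ((opaired a b)%:R * c * kdelta K (N + 1) * ((s ^+ 2 + s)%:~R / 2)) *: x.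
Proof.
move=> a1 b1.
pose h (t : int) : K := (opaired a b)%:R * c * kdelta K (N + 1) *
  ((t ^+ 2 - t)%:~R / 2 - (s * t)%:~R).
rewrite (@quad_threshold _ _ _ _ _ h) => [||t].
- by rewrite -scaleNr; congr (_ + _ *: _); rewrite /h; field.
- by rewrite /h; field.
rewrite /h obracketE /ocoef /oshift b1.
have -> : t + (N - t) + true = N + 1 by lia.
by field.
Qed.

(** G(m + 1/2) acts as an odd derivation on the four terms of G(n + 1/2). In the central term the
    background charges account for c_L - 3, and the two fermionic anomalies together for the
    remaining 3. *)
Lemma Gop_Gop m n x : Gop m (Gop n x) + Gop n (Gop m x) =
  2 *: Lop (m + n + 1) x + (kdelta K (m + n + 1) * ((m ^+ 2 + m)%:~R / 3) * cL) *: x.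
Proof.
have GE y : Gop n y = q *: ((1 / 2) *: quad 0 Oc Opsip (fun=> 1) n y
    + (1 / 2) *: quad 0 Od Opsim (fun=> 1) n y
    - (A * (n + 1)%:~R) *: mode Opsim n y + (n + 1)%:~R *: mode Opsip n y) by [].
have GZ := linZ (Gop_lin m); have GD := linD (Gop_lin m).
rewrite (GE x) (GE (Gop m x)) {GE} !(GZ, GD, linN (Gop_lin m)) Gop_psim Gop_psip.
rewrite (@quad_deriv (Gop m) true Oc Opsim Opsip Od m (m + 1)
  (fun i => - (q * i%:~R)) (fun=> q / 2) 0 (- (q * A * (m + 1)%:~R)));
  try exact: Gop_lin; try by []; first last.
- exact: Gop_psip.
- by move=> i y; rewrite Gop_c mul0r scale0r addr0.
rewrite (@quad_deriv (Gop m) true Od Opsip Opsim Oc m (m + 1)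
  (fun i => - (q * i%:~R)) (fun=> q / 2) 0 (q * (m + 1)%:~R));
  try exact: Gop_lin; try by []; first last.
- exact: Gop_psim.
- by move=> i y; rewrite Gop_d mul0r scale0r addr0.
have q2 := qq.
have -> : n + (m + 1) = m + n + 1 by lia.
have NE : m + n + 1 - 1 = n + m by lia.
(* Differentiating the boson leaves a pair of fermions ordered at threshold m; reordering gives the
   fermionic part of L, a sum with constant coefficients, and an anomaly. *)
have quad_lin_term a b : osc_odd a -> osc_odd b ->
    quad m a b (fun i => - (q * (i - m)%:~R)) (n + m) x =
    q *: quad 0 a b (fun i => - i%:~R - 1) (n + m) x
    + (q * (m + 1)%:~R) *: quad 0 a b (fun=> 1) (n + m) x
    + ((opaired a b)%:R * q * kdelta K (m + n + 1) * ((m ^+ 2 + m)%:~R / 2)) *: x.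
  move=> a1 b1; rewrite (@eq_quad _ _ _ _ (fun i => (- q) * (i - m)%:~R)) => [|i].
    rewrite quad_thresholdE //.
    rewrite (@eq_quad _ _ _ _ (fun i => (- q) * i%:~R + q * m%:~R)) => [|i].
      rewrite quad_affine; have -> : n + m + 1 = m + n + 1 by lia.
      by lmod_split; ring.
    by ring.
  by ring.
rewrite !quad_lin_term //= (quad_flip Opsip Opsim (fun=> 1)) (quad_flip Od Oc).
have half a b N : quad 0 a b (fun=> q / 2) N x = (q / 2) *: quad 0 a b (fun=> 1) N x.
  by rewrite -quadZ; apply: eq_quad => i; rewrite mulr1.
rewrite !half /Lop NE.
(* The scalar terms live on m + n + 1 = 0, where n is eliminated before coefficients are
   compared. *)
rewrite /osign /=; have [N0|N0] := eqVneq (m + n + 1) 0.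
  have nE : n%:~R = - m%:~R - 1 :> K by have -> : n = - m - 1 by [lia]; ring.
  by rewrite N0 /kdelta eqxx /A; lmod_split; field: q2 nE.
by rewrite kdelta0 //; lmod_split; field: q2.
Qed.

Lemma Lop_c m n x : Lop m (mode Oc n x) =
  mode Oc n (Lop m x) + (- n%:~R) *: mode Oc (n + m) x
  + ((m ^+ 2 + m)%:~R * kdelta K (n + m)) *: x.
Proof.
rewrite /Lop !quad_mode (mode_comm Oc Oc m) (mode_comm Od Oc m) !modeE.
rewrite /osign /ocoef /= /oshift /=.
have -> : - n - 0 = - n by lia.
have -> : m - - n = n + m by lia.
rewrite (addrC m n).
by lmod_split; field.
Qed.

Lemma Lop_d m n x : Lop m (mode Od n x) =
  mode Od n (Lop m x) + (- n%:~R) *: mode Od (n + m) x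
  + (- (A * (m ^+ 2 + m)%:~R) * kdelta K (n + m)) *: x.
Proof.
rewrite /Lop !quad_mode (mode_comm Oc Od m) (mode_comm Od Od m) !modeE.
rewrite /osign /ocoef /= /oshift /=.
have -> : - n - 0 = - n by lia.
have -> : m - - n = n + m by lia.
rewrite (addrC m n).
by lmod_split; field.
Qed.

(** The fermions are primary of conformal weight 1/2, so that, unlike for c and d, no scalar term
    appears. *)
Lemma Lop_psi (a : osc) m n x : osc_odd a -> Lop m (mode a n x) =
  mode a n (Lop m x) + (- (n%:~R + 1 / 2 + m%:~R / 2)) *: mode a (n + m) x.
Proof.
case: a => // _;
  rewrite /Lop !quad_mode 2!(mode_comm _ _ m) !modeE /osign /ocoef /= /oshift /=;
  (have -> : m - 1 - (- n - 1) = n + m by lia);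
  by lmod_split; field.
Qed.

Lemma quad_unpaired a b f s N x : opaired a b = false ->
  quad s a b f N x = quad 0 a b f N x.
Proof.
move=> ab; rewrite (@quad_threshold a b f N x (fun=> 0)) ?scale0r ?addr0 // => t.
by rewrite obracketE ab !mul0r mulr0 subr0.
Qed.

(** L(m) acts as an even derivation. A boson and a fermion are never paired, so changing the
    threshold costs nothing, and the two coefficients depending on i add up to the constant m/2 - n
    - 1/2. *)
Lemma Lop_Gop m n x : Lop m (Gop n x) =
  Gop n (Lop m x) + (m%:~R / 2 - n%:~R - 1 / 2) *: Gop (m + n) x.
Proof.
have GE k y : Gop k y = q *: ((1 / 2) *: quad 0 Oc Opsip (fun=> 1) k y
    + (1 / 2) *: quad 0 Od Opsim (fun=> 1) k y
    - (A * (k + 1)%:~R) *: mode Opsim k y + (k + 1)%:~R *: mode Opsip k y) by [].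
have LZ := linZ (Lop_lin m); have LD := linD (Lop_lin m).
rewrite !GE {GE} !(LZ, LD, linN (Lop_lin m)) !Lop_psi //.
have quadL a b (u0 : K) : osc_odd a = false -> osc_odd b -> opaired a b = false ->
    (forall i y, Lop m (mode a i y) = mode a i (Lop m y)
      + (- i%:~R) *: mode a (i + m) y + (u0 * kdelta K (i + m)) *: y) ->
    Lop m (quad 0 a b (fun=> 1) n x) = quad 0 a b (fun=> 1) n (Lop m x)
      + (m%:~R / 2 - n%:~R - 1 / 2) *: quad 0 a b (fun=> 1) (m + n) x
      + u0 *: mode b (m + n) x.
  move=> a0 b1 ab La.
  rewrite (@quad_deriv (Lop m) false a a b b m m
    (fun i => - i%:~R) (fun j => - (j%:~R + 1 / 2 + m%:~R / 2)) u0 0) //; first last.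
  - by move=> j y; rewrite Lop_psi // mul0r scale0r addr0 scale1r.
  - exact: Lop_lin.
  rewrite quad_unpaired // (addrC m n) expr0 scale1r scale0r addr0.
  have -> : (m%:~R / 2 - n%:~R - 1 / 2) *: quad 0 a b (fun=> 1) (n + m) x =
      quad 0 a b (fun i => - (i - m)%:~R) (n + m) x
      + quad 0 a b (fun i => - ((n - i)%:~R + 1 / 2 + m%:~R / 2)) (n + m) x.
    by rewrite -quadZ -quadD; apply: eq_quad => i; field.
  by lmod_split; ring.
rewrite (quadL _ _ _ _ _ _ (Lop_c m)) // (quadL _ _ _ _ _ _ (Lop_d m)) //.
rewrite (addrC m n).
by lmod_split; field.
Qed.

Lemma Lop_Lop m n x : Lop m (Lop n x) = Lop n (Lop m x) +
  (m - n)%:~R *: Lop (m + n) x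
  + (kdelta K (m + n) * ((m ^+ 3 - m)%:~R / 12 * cL)) *: x.
Proof.
(* From here on only linearity and the relations {G,G} and [L,G] enter. *)
move: Gop_lin Lop_lin Gop_Gop Lop_Gop; move: Gop Lop => G L G_lin L_lin GG LG.
(* The index -1 stands for G(-1/2), at which the central factor m^2 + m vanishes. *)
have LE k y : L k y = (1 / 2) *: (G k (G (- 1) y) + G (- 1) (G k y)).
  rewrite addrC GG; have -> : - 1 + k + 1 = k by lia.
  by lmod_split; field.
have Gm : G (m + n) (G (- 1) x) = 2 *: L (m + n) x - G (- 1) (G (m + n) x).
  by rewrite (LE (m + n)); lmod_split; field.
have Gn : G n (G (m - 1) x) = 2 *: L (m + n) x
    + (kdelta K (m + n) * ((n ^+ 2 + n)%:~R / 3) * cL) *: x - G (m - 1) (G n x).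
  have := GG n (m - 1) x; have -> : n + (m - 1) + 1 = m + n by lia.
  by move=> <-; rewrite addrK.
rewrite (LE n x) (LE n (L m x)) (linZ (L_lin m)) (linD (L_lin m)).
rewrite !LG !(linD (G_lin _)) !(linZ (G_lin _)) Gm Gn.
have [N0|N0] := eqVneq (m + n) 0.
  have nE : n%:~R = - m%:~R :> K by have -> : n = - m by [lia]; ring.
  by rewrite N0 /kdelta eqxx; lmod_split; field: nE.
by rewrite kdelta0 //; lmod_split; field.
Qed.

(** * Comparison with the modes of the vertex operators *)

Lemma zsum_nat1 (F : int -> M) : fin_supp F -> F (- 1) = 0 ->
  \sum_(j \in [set: nat]%classic) (F (- 2 - j%:Z) + F j%:Z) = zsum F.
Proof.
move=> Fs F1.
pose Fn i := if i < 0 then F i else 0; pose Fp i := if i < 0 then 0 else F i.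
have [Fns Fps] : fin_supp Fn /\ fin_supp Fp.
  by case: Fs => T FT; split; exists T => i iT; rewrite /Fn /Fp FT ?if_same.
have -> : zsum F = zsum Fn + zsum Fp.
  rewrite -zsumD //; apply: eq_zsum => i; rewrite /Fn /Fp.
  by case: ifP; rewrite ?addr0 ?add0r.
have Fns' := fin_supp_shift (- 1) Fns.
rewrite (zsum_shift Fn (- 1)) -zsumD // -zsum_nat; last exact: fin_suppD.
apply: eq_fsbigr => j _; rewrite /Fn /Fp.
have -> : - 1 - j%:Z - 1 = - 2 - j%:Z by lia.
have -> : - 2 - j%:Z < 0 by lia.
have -> : - 1 - j%:Z < 0 by lia.
have -> : (j%:Z < 0) = false by lia.
rewrite addr0; case: ifP => j0; last by rewrite add0r.
by have -> : j%:Z - 1 = - 1 by [lia]; rewrite F1 add0r.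
Qed.

(** Coefficient of a(i) in the k-th divided derivative of the field a, for k = 0 and k = 1, the only
    depths in τ and ω. For k = 1 it vanishes at i = -1, the index skipped in [zsum_nat1]. *)
Definition dcoef (k : nat) (i : int) : K := if k is 0 then 1 else - i%:~R - 1.

(** The two halves of the sum over natural numbers join into one sum over all integers i, negative i
    being the creation part; [dcoef] absorbs the binomial coefficient and the sign (-1)^k. *)
Lemma vop_cons (a : osc) (k : nat) (w : word) n x : (k <= 1)%N ->
    let F i := dcoef k i *: (if i < 0 then mode a i (vop_word w (n - k%:Z - 1 - i) x)
      else (-1) ^+ (osc_odd a && word_odd w) *:
        vop_word w (n - k%:Z - 1 - i) (mode a i x)) in
  fin_supp F -> vop_word ((a, k) :: w) n x = zsum F.
Proof.
case: k => [|[|//]] _ F Fs.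
  rewrite -zsum_nat //=; apply: eq_fsbigr => j _; rewrite /F.
  have -> : - 1 - j%:Z < 0 by lia.
  have -> : (j%:Z < 0) = false by lia.
  rewrite !scale1r binn scale1r sub0r -/(mode a _ _) -/(mode a _ _) add0n.
  by congr (mode a _ (vop_word _ _ _) + _ *: vop_word _ _ _); lia.
rewrite -zsum_nat1 //=; last by rewrite /F /= opprK subrr scale0r.
apply: eq_fsbigr => j _; rewrite /F.
have -> : - 2 - j%:Z < 0 by lia.
have -> : (j%:Z < 0) = false by lia.
rewrite /= -/(mode a _ _) -/(mode a _ _) add1n exprS binSn.
have -> : n + j%:Z = n - 1%:Z - 1 - (- 2 - j%:Z) by lia.
have -> : - 1%:Z - 1 - j%:Z = - 2 - j%:Z by lia.
by lmod_split; ring.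
Qed.

(** The field of the vacuum has the single mode -1, so only one summand survives. *)
Lemma vop_word1 a k n x : (k <= 1)%N ->
  vop_word [:: (a, k)] n x = dcoef k (n - k%:Z) *: mode a (n - k%:Z) x.
Proof.
move=> k1; set y := RHS.
pose F i := dcoef k i *: (if i < 0 then mode a i (vop_word [::] (n - k%:Z - 1 - i) x)
      else (-1) ^+ (osc_odd a && word_odd [::]) *:
        vop_word [::] (n - k%:Z - 1 - i) (mode a i x)).
have FE i : F i = if i == n - k%:Z then y else 0.
  rewrite /F /= andbF scale1r.
  have -> : (n - k%:Z - 1 - i == - 1) = (i == n - k%:Z) by lia.
  by case: eqP => [->|_]; rewrite ?if_same // (lin0 (mode_lin _ _)) if_same scaler0.
rewrite vop_cons // -/F; last first.
  by exists (absz (n - k%:Z)).+1 => i ik; rewrite FE; case: eqP => // ?; lia.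
by rewrite (zsum1 (i0 := n - k%:Z)) => [|i /negPf i0]; rewrite FE ?eqxx ?i0.
Qed.

Transparent quad nop.

Lemma vop_word2 a k b n x : (k <= 1)%N ->
  vop_word [:: (a, k); (b, 0%N)] n x = quad 0 a b (dcoef k) (n - k%:Z - 1) x.
Proof.
move=> k1; have nopE i : nop 0 a b i (n - k%:Z - 1 - i) x =
    if i < 0 then mode a i (vop_word [:: (b, 0%N)] (n - k%:Z - 1 - i) x)
    else (-1) ^+ (osc_odd a && word_odd [:: (b, 0%N)]) *:
      vop_word [:: (b, 0%N)] (n - k%:Z - 1 - i) (mode a i x).
  by rewrite /nop !vop_word1 // !scale1r !subr0 /osign /= addbF.
rewrite vop_cons //; first by apply: eq_zsum => i; rewrite nopE.
apply: eq_fin_supp (nop_fin_supp 0 a b (dcoef k) (n - k%:Z - 1) x) => i.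
by rewrite nopE.
Qed.

Opaque quad nop.

(** * The action of SH on modules over the oscillators *)

Variable cLa : K.
Local Notation fact := (@free_field_act K cL cLa M).

Transparent Gop Lop.

Lemma free_field_L n x : fact (SL n : SH K) x = Lop n x.
Proof.
rewrite -[LHS]/(vop (st_omega cL) (n + 1) x) /vop /st_omega /st_omega_fer /cat.
rewrite !big_cons big_nil; cbn [fst snd]; rewrite !vop_word2 // !vop_word1 //.
rewrite /Lop /A.
have -> : n + 1 - 0%:Z - 1 = n by lia.
have -> : n + 1 - 1%:Z = n by lia.
by rewrite /dcoef /= -/(mode _ _ _); lmod_split; field.
Qed.

Lemma free_field_G n x : fact (SG n : SH K) x = Gop n x.
Proof.
rewrite -[LHS]/(vop (st_tau cL) (n + 1) x) /vop /st_tau.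
rewrite !big_cons big_nil; cbn [fst snd]; rewrite !vop_word2 // !vop_word1 //.
rewrite /Gop /A -/q.
have -> : n + 1 - 0%:Z - 1 = n by lia.
have -> : n + 1 - 1%:Z = n by lia.
by rewrite /dcoef /=; lmod_split; field.
Qed.

Opaque Gop Lop.

Lemma free_field_alpha n x :
  fact (Salpha n : SH K) x = (- cLa) *: mode Oc n x.
Proof.
rewrite -[LHS]/(vop (st_alpha cLa) n x) /vop big_seq1; cbn [fst snd].
by rewrite vop_word1 //= scale1r subr0.
Qed.

Lemma free_field_psi n x :
  fact (SPsi n : SH K) x = (- (q * cLa)) *: mode Opsim n x.
Proof.
rewrite -[LHS]/(vop (st_psi cLa) n x) /vop big_seq1; cbn [fst snd].
by rewrite vop_word1 //= scale1r subr0.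
Qed.

Definition ffE := (free_field_L, free_field_G, free_field_alpha, free_field_psi).

Lemma free_field_lin (b : SH K) : linear (fact b).
Proof.
case: b => [n|n|n|n|||] c x y; rewrite ?ffE.
- exact: Lop_lin.
- by rewrite mode_lin; lmod_split; ring.
- exact: Gop_lin.
- by rewrite mode_lin; lmod_split; ring.
- by rewrite /=; lmod_split; ring.
- by rewrite /= scaler0 addr0.
- by rewrite /=; lmod_split; ring.
Qed.

Lemma free_field_table (a b : SH K) s x : sh_table K a b = Some s ->
  fact a (fact b x)
    - ssign a b *: fact b (fact a x) =
  \sum_(t <- s) t.1 *: fact t.2 x.
Proof.
have q2 := qq; rewrite /ssign.
case: a => [m|m|m|m|||]; case: b => [n|n|n|n|||] // [<-];
  rewrite ?big_cons big_nil; cbn [fst snd]; rewrite ?ffE ?expr0 ?expr1 ?scale1r.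
- by rewrite Lop_Lop /=; lmod_split; field.
- by rewrite (linZ (Lop_lin m)) Lop_c (addrC n m) /=; lmod_split; field.
- by rewrite Lop_Gop; lmod_split; field.
- by rewrite !modeE mode_comm /osign /=; lmod_split; field: q2.
- by rewrite (linZ (Gop_lin n)) Gop_c /=; lmod_split; field.
- by rewrite !modeE mode_comm /osign /=; lmod_split; field: q2.
- have -> : Gop m (Gop n x) = 2 *: Lop (m + n + 1) x
      + (kdelta K (m + n + 1) * ((m ^+ 2 + m)%:~R / 3) * cL) *: x - Gop n (Gop m x).
    by rewrite -Gop_Gop addrK.
  by rewrite /=; lmod_split; field.
- by rewrite (linZ (Lop_lin _)) Lop_psi //=; lmod_split; field.
- rewrite (linZ (Gop_lin _)) Gop_psim //= addrA.
  have [N0|N0] := eqVneq (m + n + 1) 0.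
    have nE : n%:~R = - m%:~R - 1 :> K by have -> : n = - m - 1 by [lia]; ring.
    by rewrite N0 /kdelta eqxx; lmod_split; field: q2 nE.
  by rewrite kdelta0 //; lmod_split; field: q2.
- by rewrite !modeE mode_comm /osign /=; lmod_split; field: q2.
Qed.

(** A pair outside the table is the reverse of a listed pair, treated by super antisymmetry, or
    contains a central element, which acts by a scalar. *)
Lemma free_field_bracket (a b : SH K) x :
  fact a (fact b x) - ssign a b *: fact b (fact a x) =
  \sum_(t <- sbracket a b) t.1 *: fact t.2 x.
Proof.
have [[s ab]|ab] : {s | sh_table K a b = Some s} + {sh_table K a b = None}.
  by case: (sh_table K a b) => [s|]; [left; exists s|right].
  by rewrite [sbracket a b]/(sh_bracket K a b) /sh_bracket ab; exact: free_field_table.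
have [[s ba]|ba] : {s | sh_table K b a = Some s} + {sh_table K b a = None}.
  by case: (sh_table K b a) => [s|]; [left; exists s|right].
  rewrite [sbracket a b]/(sh_bracket K a b) /sh_bracket ab ba big_map /=.
  have sab : ssign a b = ssign b a :> K by rewrite /ssign andbC.
  have ss : ssign a b * ssign a b = 1 :> K by rewrite /ssign -signr_addb addbb.
  under eq_bigr do rewrite -scalerA.
  rewrite -scaler_sumr -(free_field_table x ba) -/(ssign a b) -sab.
  by lmod_split; ring: ss.
rewrite [sbracket a b]/(sh_bracket K a b) /sh_bracket ab ba big_nil.
by case: a ab ba => [m|m|m|m|||]; case: b => [n|n|n|n|||] // _ _;
  rewrite ?ffE /ssign /= ?(linZ (Lop_lin _)) ?(linZ (Gop_lin _)) ?modeE
    ?(lin0 (Lop_lin _)) ?(lin0 (Gop_lin _)) ?(lin0 (mode_lin _ _));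
  lmod_split; ring.
Qed.

Local Notation par := (@parity _ _ M).

Lemma parity_mode a n x : par (mode a n x) = (-1) ^+ osc_odd a *: mode a n (par x).
Proof. exact: (parity_act M_mod (Osc a n : heis_cliff K)). Qed.

Transparent nop quad.

Lemma parity_quad a b f N x : par (quad 0 a b f N x) =
  (-1) ^+ (osc_odd a (+) osc_odd b) *: quad 0 a b f N (par x).
Proof.
have par_lin := parity_lin M_mod.
have Fs := nop_fin_supp 0 a b f N.
rewrite /quad (zsum_lin par_lin (Fs x)) -zsumZ //; apply: eq_zsum => i.
rewrite (linZ par_lin) /nop signr_addb; case: ifP => _.
  by rewrite !parity_mode modeE; lmod_split; ring.
by rewrite (linZ par_lin) !parity_mode modeE; lmod_split; ring.
Qed.

Opaque nop quad.



Transparent Gop Lop.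

Lemma parity_Lop n x : par (Lop n x) = Lop n (par x).
Proof.
have par_lin := parity_lin M_mod; rewrite /Lop.
rewrite !(linD par_lin, linZ par_lin, linN par_lin) !parity_quad !parity_mode /=.
by lmod_split; ring.
Qed.

Lemma parity_Gop n x : par (Gop n x) = - Gop n (par x).
Proof.
have par_lin := parity_lin M_mod; rewrite /Gop.
rewrite !(linD par_lin, linZ par_lin, linN par_lin) !parity_quad !parity_mode /=.
by lmod_split; ring.
Qed.

Opaque Gop Lop.

Lemma free_field_is_module : is_module (free_field cL cLa M).
Proof.
have par_lin := parity_lin M_mod.
split; [exact: free_field_lin|exact: par_lin|exact: parity_inv M_mod| |
  exact: free_field_bracket].
move=> b x; have : par (fact b x) = (-1) ^+ sodd b *: fact b (par x); last by [].
case: b => [n|n|n|n|||]; rewrite ?ffE ?parity_Lop ?parity_Gop ?(linZ par_lin)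
  ?parity_mode ?expr0 ?expr1 ?scale1r //; try by lmod_split; ring.
by rewrite [fact _ _](erefl : _ = 0) (lin0 par_lin).
Qed.

End Oscillators.

(** * Ordered words span *)

Section Span.
Variables (K : fieldType) (V : lmodType K).
Implicit Types S T : V -> Prop.

Inductive spanned S : V -> Prop :=
| spanned0 : spanned S 0
| spannedS a x y : S x -> spanned S y -> spanned S (a *: x + y).

Lemma spanned_in S x : S x -> spanned S x.
Proof.
by move=> Sx; rewrite -[x]scale1r -[_ *: x]addr0; apply: spannedS => //; left.
Qed.

Lemma spannedD S x y : spanned S x -> spanned S y -> spanned S (x + y).
Proof.
elim=> [|a u v Su _ IH] Sy; rewrite ?add0r // -addrA.
by apply: spannedS => //; exact: IH.
Qed.

Lemma spannedZ S a x : spanned S x -> spanned S (a *: x).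
Proof.
elim=> [|b u v Su _ IH]; first by rewrite scaler0; left.
by rewrite scalerDr scalerA; apply: spannedS.
Qed.

Lemma spannedB S x y : spanned S x -> spanned S y -> spanned S (x - y).
Proof. by move=> Sx Sy; rewrite -scaleN1r; apply/spannedD/spannedZ. Qed.

Lemma spanned_sum S (I : Type) (r : seq I) (P : pred I) (F : I -> V) :
  (forall i, P i -> spanned S (F i)) -> spanned S (\sum_(i <- r | P i) F i).
Proof. by move=> SF; apply: big_ind => //; [left | exact: spannedD]. Qed.

Lemma spanned_bind S T x :
  (forall y, S y -> spanned T y) -> spanned S x -> spanned T x.
Proof.
move=> ST; elim=> [|a u v /ST Tu _ IH]; first by left.
exact/spannedD/IH/spannedZ.
Qed.

Lemma spanned_family (W : eqType) (P : W -> Prop) (E : W -> V) x :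
    spanned (fun y => exists w, P w /\ y = E w) x ->
  exists s : seq (K * W), (forall t, t \in s -> P t.2) /\
    x = \sum_(t <- s) t.1 *: E t.2.
Proof.
elim=> [|a u v [w [Pw ->]] _ [s [sP ->]]]; first by exists [::]; rewrite big_nil.
exists ((a, w) :: s); rewrite big_cons; split=> // t.
by rewrite inE => /orP[/eqP ->|/sP].
Qed.
End Span.

Lemma spanned_lin (K : fieldType) (V W : lmodType K) (u : V -> W)
    (S : V -> Prop) (T : W -> Prop) x :
  linear u -> (forall y, S y -> spanned T (u y)) -> spanned S x -> spanned T (u x).
Proof.
move=> u_lin ST; elim=> [|a y z /ST Ty _ IH].
  by rewrite (lin0 u_lin); left.
by rewrite u_lin; apply/spannedD/IH/spannedZ.
Qed.

Definition wact (K : fieldType) (g : superlie K) (M : srep g) (w : seq g) (x : M) : M :=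
  foldr (fun b y => act b y) x w.

(** * Reordering words in a highest weight module *)

Section OrderedWords.
Variables (K : fieldType) (g : superlie K) (hw : g -> option K).
Variable cr : nat -> g.
Hypotheses (K2 : (2 : K) != 0)
  (hw_odd : forall b x, hw b = Some x -> sodd b -> x = 0)
  (crP : forall b, (exists i, b = cr i) \/ (exists c, hw b = Some c)).
Local Notation V := (hwmod hw).

(** Only even letters may be repeated: the square of an odd element is half its bracket with
    itself. *)
Definition letter_le (i j : nat) : bool :=
  (i < j)%N || (i == j) && ~~ sodd (cr i).

Definition ordered (s : seq nat) : bool := pairwise letter_le s.

(** The length filtration, once with arbitrary words and once, in [Tspan], with ordered monomials;
    [Uspan_Tspan] is the spanning half of the Poincaré-Birkhoff-Witt theorem. *)
Definition Uspan (k : nat) : V -> Prop :=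
  spanned (fun x => exists w, (size w <= k)%N /\ x = wact w (hwgen hw)).

Definition Tspan (k : nat) : V -> Prop :=
  spanned (fun x => exists s, (ordered s /\ (size s <= k)%N) /\
    x = wact (map cr s) (hwgen hw)).

Let V_mod := hwmod_is_module hw_odd.

Lemma wact_lin w : linear (@wact K g V w).
Proof.
elim: w => [//|b w IH] a x y /=; rewrite IH; exact: (act_lin V_mod).
Qed.

Lemma Uspan_act k b x : Uspan k x -> Uspan k.+1 (act b x).
Proof.
apply: spanned_lin; first exact: (act_lin V_mod).
by move=> y [w [wk ->]]; apply: spanned_in; exists (b :: w).
Qed.

Lemma Uspan_wact k w x : Uspan k x -> Uspan (size w + k) (wact w x).
Proof. by move=> Ux; elim: w => [//|b w IH] /=; apply: Uspan_act. Qed.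

Lemma Uspan_le k l x : (k <= l)%N -> Uspan k x -> Uspan l x.
Proof.
move=> kl; apply: spanned_bind => y [w [wk ->]]; apply: spanned_in.
by exists w; split=> //; exact: leq_trans kl.
Qed.

Lemma Tspan_le k l x : (k <= l)%N -> Tspan k x -> Tspan l x.
Proof.
move=> kl; apply: spanned_bind => y [s [[so sk] ->]]; apply: spanned_in.
by exists s; do !split=> //; exact: leq_trans kl.
Qed.

(** Each transposition costs a sign, collected in [e], and a bracket, which replaces two letters by
    one and so shortens the word. *)
Lemma wact_move b w x k : Uspan k x ->
  exists e : K, Uspan (size w + k) (act b (wact w x) - e *: wact w (act b x)).
Proof.
move=> Ux; elim: w => [|a w [e IH]].
  by exists 1; rewrite /= scale1r subrr; left.
exists (ssign b a * e) => /=.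
set y := act b (act a (wact w x)).
have -> : y - (ssign b a * e) *: act a (wact w (act b x)) =
    (y - ssign b a *: act a (act b (wact w x)))
    + ssign b a *: act a (act b (wact w x) - e *: wact w (act b x)).
  rewrite (linD (act_lin V_mod a)) (linN (act_lin V_mod a)) (linZ (act_lin V_mod a)).
  by lmod_split; ring.
apply: spannedD; last exact/spannedZ/Uspan_act.
rewrite /y (act_bracket V_mod); apply: spanned_sum => t _; apply: spannedZ.
exact/Uspan_act/Uspan_wact.
Qed.

Lemma ordered_split j s : ordered s ->
  exists s1 s2, [/\ s = s1 ++ s2, all (fun i => i < j)%N s1 & all (leq j) s2].
Proof.
elim: s => [|i s IH]; first by exists [::], [::].
rewrite /ordered /= => /andP[ih so]; have [ij|ji] := ltnP i j; last first.
  exists [::], (i :: s); split=> //=; rewrite ji /=.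
  apply/allP => k /(allP ih); rewrite /letter_le => /orP[ik|/andP[/eqP <- //]].
  exact: leq_trans ji (ltnW ik).
by have [s1 [s2 [-> s1j s2j]]] := IH so; exists (i :: s1), s2; rewrite /= ij.
Qed.

(** The new letter is moved to its place in the ordered word; the errors are shorter words, which
    [UT] already orders. *)
Lemma Tspan_insert k b s : (forall x, Uspan k x -> Tspan k x) ->
  ordered s -> (size s <= k)%N ->
  Tspan k.+1 (act b (wact (map cr s) (hwgen hw))).
Proof.
move=> UT so sk.
have U0 : Uspan 0 (hwgen hw) by apply: spanned_in; exists [::].
have Uw w : Uspan (size w) (wact w (hwgen hw)).
  by have := Uspan_wact w U0; rewrite addn0.
have [[j ->]|[c bc]] := crP b; last first.
  (* A letter with prescribed action is moved all the way to the generator, where it becomes a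
     scalar. *)
  have [e] := wact_move b (map cr s) U0; rewrite size_map addn0 => Ue.
  rewrite -[act b _](subrK (e *: wact (map cr s) (act b (hwgen hw)))).
  apply: (Tspan_le (leqnSn k)); apply: spannedD.
    exact/UT/(Uspan_le sk).
  rewrite (proj2 (hwgen_is_hwv hw_odd) b c bc) (linZ (wact_lin _)).
  by do 2!apply: spannedZ; apply: spanned_in; exists s.
have [s1 [s2 [sE s1j s2j]]] := ordered_split j so.
have [e] := wact_move (cr j) (map cr s1) (Uw (map cr s2)).
rewrite !size_map -size_cat -sE => Ue.
have -> : wact (map cr s) (hwgen hw) = wact (map cr s1) (wact (map cr s2) (hwgen hw)).
  by rewrite sE map_cat /wact foldr_cat.
set y := act (cr j) _; rewrite -[y](subrK (e *: wact (map cr s1)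
  (act (cr j) (wact (map cr s2) (hwgen hw))))) {}/y.
apply: spannedD; first exact/(Tspan_le (leqnSn k))/UT/(Uspan_le sk).
apply: spannedZ.
have [o1 o2 o12] : [/\ ordered s1, ordered s2 & allrel letter_le s1 s2].
  by move: so; rewrite sE /ordered pairwise_cat => /and3P[].
(* If the letter is odd and already present, it is the head of [s2]; the resulting square is half a
   bracket, so the word gets shorter. *)
have [/andP[jodd js2]|nj] := boolP (sodd (cr j) && (j \in s2)).
  case: s2 js2 s2j o2 {o12 Ue} sE => // i s2.
  rewrite inE => js2 /= /andP[ji s2j] /andP[io _] sE.
  have ij : i = j.
    apply/eqP; rewrite eqn_leq ji andbT; case/orP: js2 => [/eqP -> //|/(allP io)].
    by case/orP => [/ltnW //|/andP[/eqP ->]].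
  subst i; apply: (Tspan_le (leqnSn k)); apply: UT; apply: (Uspan_le sk).
  rewrite sE size_cat -(size_map cr s1); apply: Uspan_wact.
  pose x : V := wact (map cr s2) (hwgen hw); pose y : V := act (cr j) (act (cr j) x).
  suff: Uspan (size s2).+1 y by [].
  have := act_bracket V_mod (cr j) (cr j) x.
  rewrite /ssign jodd andbb expr1 scaleN1r opprK.
  rewrite -/y -mulr2n -scaler_nat => jj.
  rewrite -[y]scale1r -(mulVf K2) -scalerA jj; apply: spannedZ.
  apply: spanned_sum => t _; apply: spannedZ; apply: Uspan_act.
  by rewrite -(size_map cr s2); exact: Uw.
apply: spanned_in; exists (s1 ++ j :: s2); split; last first.
  by rewrite map_cat /wact foldr_cat.
split; last by move: sk; rewrite sE !size_cat /= addnS ltnS.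
rewrite /ordered pairwise_cat allrel_consr o12 andbT /=; apply/and4P; split=> //.
- by apply/allP => i /(allP s1j); rewrite /letter_le => ->.
- apply/allP => i is2; rewrite /letter_le; move: (allP s2j i is2).
  rewrite leq_eqVlt => /orP[/eqP ji|-> //]; move: nj; rewrite {2}ji is2 andbT.
  by rewrite ji eqxx /= => ->; rewrite orbT.
Qed.

Lemma Uspan_Tspan k x : Uspan k x -> Tspan k x.
Proof.
elim: k x => [|k IH] x; apply: spanned_bind => y [[|b w] [wk ->]] //;
  try by apply: spanned_in; exists [::].
have /IH : Uspan k (wact w (hwgen hw)) by apply: spanned_in; exists w.
apply: spanned_lin; first exact: (act_lin V_mod).
by move=> z [s [[so sk] ->]]; apply: Tspan_insert.
Qed.

Lemma Uspan_all (x : V) : exists k, Uspan k x.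
Proof.
elim/hwspace_ind: x; elim=> [||x [k Ux] y [l Uy]|a x [k Ux]|b x [k Ux]].
- by exists 0%N; apply: spanned_in; exists [::]; split.
- by exists 0%N; left.
- rewrite hwclsD; exists (maxn k l); apply: spannedD.
    exact: Uspan_le (leq_maxl _ _) Ux.
  exact: Uspan_le (leq_maxr _ _) Uy.
- by rewrite hwclsZ; exists k; apply: spannedZ.
- by exists k.+1; rewrite -hwactE; exact: Uspan_act.
Qed.

Lemma hwmod_ordered_span (x : V) :
  exists s : seq (K * seq nat), (forall t, t \in s -> ordered t.2) /\
    x = \sum_(t <- s) t.1 *: wact (map cr t.2) (hwgen hw).
Proof.
have [k /Uspan_Tspan Tx] := Uspan_all x.
apply: (@spanned_family _ _ _ (fun s => ordered s)
  (fun s => wact (map cr s) (hwgen hw))).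
apply: spanned_bind Tx => y [s [[so _] ->]].
by apply: spanned_in; exists s.
Qed.

End OrderedWords.

(** * Occupation numbers *)

Section Evaluation.
Variables (K : fieldType) (g : superlie K) (hw : g -> option K).
Variables (P : lmodType K) (op : g -> P -> P) (w : P).
Hypotheses (hw_odd : forall b x, hw b = Some x -> sodd b -> x = 0)
  (op_lin : forall b, linear (op b))
  (op_bracket : forall a b x, op a (op b x) - ssign a b *: op b (op a x) =
     \sum_(t <- sbracket a b) t.1 *: op t.2 x)
  (op_hwv : forall b x, hw b = Some x -> op b w = x *: w).

(* [P] carries no parity; [P * P], with odd elements exchanging the factors,
   does, and addition maps it back to [P]. *)
Definition double_act (b : g) (z : (P * P)%type) : (P * P)%type :=
  if sodd b then (op b z.2, op b z.1) else (op b z.1, op b z.2).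

Definition double : srep g :=
  @SRep K g (P * P)%type double_act (fun z => (z.1, - z.2)).

Lemma double_is_module : is_module double.
Proof.
split=> /=.
- move=> b a [x1 x2] [y1 y2]; rewrite /double_act /=.
  by case: ifP => _; rewrite !op_lin.
- by move=> a [x1 x2] [y1 y2]; apply/pair_equal_spec; rewrite /= opprD scalerN.
- by move=> [x y] /=; rewrite opprK.
- move=> b [x y]; rewrite /double_act /=; case: ifP => _ /=;
    rewrite ?expr1 ?expr0 ?scale1r ?scaleN1r (linN (op_lin b)).
    by apply/pair_equal_spec; rewrite /= opprK.
  by [].
- move=> a b [x y].
  have bracketE z : \sum_(t <- sbracket a b) t.1 *: double_act t.2 z =
      let u := \sum_(t <- sbracket a b) t.1 *: op t.2 z.1 in
      let v := \sum_(t <- sbracket a b) t.1 *: op t.2 z.2 in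
      if sodd a (+) sodd b then
        (\sum_(t <- sbracket a b) t.1 *: op t.2 z.2,
         \sum_(t <- sbracket a b) t.1 *: op t.2 z.1)
      else (\sum_(t <- sbracket a b) t.1 *: op t.2 z.1,
            \sum_(t <- sbracket a b) t.1 *: op t.2 z.2).
    move: (sbracket_odd a b); elim: (sbracket a b) => [|t s IH] /=.
      by rewrite !big_nil; case: ifP.
    case/andP => /eqP te /IH {}IH; rewrite !big_cons IH /double_act te.
    by case: ifP.
  rewrite bracketE /= -!op_bracket /double_act /ssign.
  by case: (sodd a); case: (sodd b).
Qed.

(** The universal map goes to the doubled module; adding the coordinates cancels their exchange by
    odd elements and respects the action. *)
Lemma hwmod_eval : exists f : hwmod hw -> P, [/\ linear f,
  forall b x, f (act b x) = op b (f x) & f (hwgen hw) = w].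
Proof.
have hwv : is_hwv hw ((w, 0) : double).
  split=> [|b x bx]; first by rewrite /= oppr0.
  rewrite /= /double_act /= (op_hwv bx) (lin0 (op_lin b)).
  case: ifP => [/(hw_odd bx) ->|_]; apply/pair_equal_spec; rewrite /= ?scaler0 //.
  by rewrite scale0r.
have [f [[fact_ _] fgen _]] := hwmod_universal hw_odd double_is_module hwv.
exists (fun x => (f x).1 + (f x).2); split=> [a x y|b x|].
- by rewrite linearP /= scalerDr addrACA.
- rewrite fact_ /= /double_act; case: ifP => _ /=; rewrite (linD (op_lin b)) //.
  by rewrite addrC.
- by rewrite fgen addr0.
Qed.

End Evaluation.

(* Creation modes are numbered: [osc_letter a k] stands for a_(-k-1). *)
Definition letter_osc (i : nat) : osc :=
  match (i %% 4)%N with 0 => Oc | 1 => Od | 2 => Opsip | _ => Opsim end.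

Definition osc_letter (a : osc) (k : nat) : nat :=
  (4 * k + match a with Oc => 0 | Od => 1 | Opsip => 2 | Opsim => 3 end)%N.

Lemma osc_letterK a k : letter_osc (osc_letter a k) = a.
Proof. by rewrite /letter_osc /osc_letter mulnC modnMDl; case: a. Qed.

Lemma osc_letter_div a k : (osc_letter a k %/ 4)%N = k.
Proof. by rewrite /osc_letter; case: a; lia. Qed.

Lemma letter_oscK i : osc_letter (letter_osc i) (i %/ 4) = i.
Proof.
rewrite /letter_osc /osc_letter.
have := ltn_pmod i (isT : (0 < 4)%N); have := divn_eq i 4.
by case: (i %% 4)%N => [|[|[|[|]]]] //; lia.
Qed.

(** * Creation and annihilation on functions of occupation numbers *)

Section Occupation.
Variable K : numClosedFieldType.

(* Vectors are arbitrary functions of the occupation numbers of the creation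
   letters.  Only the parity of a fermionic occupation number matters, so that
   no separate type of fermionic states is needed. *)
Definition occ_space : lmodType K := ((nat -> nat) -> K^o : lmodType K).

Definition upd (m : nat -> nat) (i k : nat) : nat -> nat :=
  fun j => if j == i then k else m j.

Definition lodd (i : nat) : bool := osc_odd (letter_osc i).

(** The Jordan-Wigner sign, from the fermions in front of letter i. *)
Definition msign (i : nat) (m : nat -> nat) : K :=
  \prod_(j < i | lodd j) (-1) ^+ m j.

(** The bracket of a creation mode with the annihilation mode paired with it: 1 for fermions, 2n for
    c(n) with d(-n) or d(n) with c(-n). *)
Definition kappa (i : nat) : K :=
  if lodd i then 1 else 2 * ((i %/ 4).+1)%:R.

(** Values of a function are read as coefficients of monomials: for even letters creation multiplies
    by a variable, and annihilation is [kappa] times the derivative in it. *)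
Definition cre_coef (i : nat) (m : nat -> nat) : K :=
  if lodd i then (odd (m i))%:R * msign i m else (0 < m i)%N%:R.

Definition ann_coef (i : nat) (m : nat -> nat) : K :=
  if lodd i then (~~ odd (m i))%:R * msign i m else kappa i * (m i).+1%:R.

Definition cre (i : nat) (f : occ_space) : occ_space :=
  fun m => cre_coef i m * f (upd m i (m i).-1).

Definition ann (i : nat) (f : occ_space) : occ_space :=
  fun m => ann_coef i m * f (upd m i (m i).+1).

Lemma updE m i k : upd m i k i = k. Proof. by rewrite /upd eqxx. Qed.

Lemma upd_neq m i k j : j != i -> upd m i k j = m j.
Proof. by rewrite /upd => /negPf ->. Qed.

Lemma upd_upd m i k l : upd (upd m i k) i l = upd m i l.
Proof. by apply/funext => j; rewrite /upd; case: eqP. Qed.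

Lemma upd_id m i : upd m i (m i) = m.
Proof. by apply/funext => j; rewrite /upd; case: eqP => // ->. Qed.

Lemma updC m i j k l : i != j -> upd (upd m i k) j l = upd (upd m j l) i k.
Proof.
move=> ij; apply/funext => n; rewrite /upd; case: (eqVneq n j) => // ->.
by rewrite eq_sym (negPf ij).
Qed.

Lemma msign_upd i m j k : msign i (upd m j k) =
  if lodd j && (j < i)%N then (-1) ^+ (m j + k) * msign i m else msign i m.
Proof.
have [/andP[oj ji]|nji] := boolP (lodd j && (j < i)%N); last first.
  apply: eq_bigr => l ol; rewrite upd_neq //; apply: contraNneq nji => <-.
  by rewrite ol ltn_ord.
rewrite /msign (bigD1 (Ordinal ji)) //= [in RHS](bigD1 (Ordinal ji)) //= updE.
rewrite mulrA -exprD; congr (_ * _).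
  by rewrite -[RHS]signr_odd !oddD addbAC addbb signr_odd.
by apply: eq_bigr => l /andP[_ lj]; rewrite upd_neq.
Qed.

Definition lsign (i j : nat) : K := (-1) ^+ (lodd i && lodd j).

Lemma msign_sq i m : msign i m * msign i m = 1.
Proof. by rewrite -big_split big1 //= => j _; rewrite -expr2 sqrr_sign. Qed.

(* Two elementary operations at different letters supercommute as soon as each
   changes the parity of its occupation number. *)
Lemma coef_comm (ci cj : nat -> (nat -> nat) -> K)
    (di dj : nat -> nat) i j m :
    i != j ->
    (ci i m != 0 -> lodd i -> odd (m i + di (m i))) ->
    (cj j m != 0 -> lodd j -> odd (m j + dj (m j))) ->
    (forall k, exists e : nat -> K, forall m', ci k m' =
        e (m' k) * (if lodd k then msign k m' else 1)) ->
    (forall k, exists e : nat -> K, forall m', cj k m' =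
        e (m' k) * (if lodd k then msign k m' else 1)) ->
  ci i m * cj j (upd m i (di (m i))) =
  lsign i j * (cj j m * ci i (upd m j (dj (m j)))).
Proof.
move=> ij oi oj /(_ i) [ei eiE] /(_ j) [ej ejE].
have ji : j != i by rewrite eq_sym.
move: oi oj; rewrite !eiE !ejE (upd_neq _ _ ij) (upd_neq _ _ ji).
rewrite !msign_upd /lsign.
have [->|ei0] := eqVneq (ei (m i)) 0; first by rewrite !mul0r !mulr0.
have [->|ej0] := eqVneq (ej (m j)) 0; first by rewrite !mul0r !mulr0.
have sgn0 k : (if lodd k then msign k m else 1) != 0.
  case: ifP => _; last exact: oner_neq0.
  by apply: contraTneq (oner_neq0 K) => s0; rewrite -(msign_sq k m) s0 mul0r eqxx.
rewrite !mulf_neq0 // => /(_ isT) oi /(_ isT) oj.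
case li: (lodd i) oi => [] oi; case lj: (lodd j) oj => [] oj /=; try ring.
rewrite -signr_odd oi // -[(-1) ^+ (m j + _)]signr_odd oj // !expr1.
have [?|?|eij] := ltngtP i j; last by rewrite eij eqxx in ij.
all: by ring.
Qed.

Lemma cre_coefE k : exists e : nat -> K, forall m,
  cre_coef k m = e (m k) * (if lodd k then msign k m else 1).
Proof.
exists (fun n => if lodd k then (odd n)%:R else (0 < n)%N%:R) => m.
by rewrite /cre_coef; case: ifP; rewrite ?mulr1.
Qed.

Lemma ann_coefE k : exists e : nat -> K, forall m,
  ann_coef k m = e (m k) * (if lodd k then msign k m else 1).
Proof.
exists (fun n => if lodd k then (~~ odd n)%:R else kappa k * n.+1%:R) => m.
by rewrite /ann_coef; case: ifP; rewrite ?mulr1.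
Qed.

Lemma cre_odd k m : cre_coef k m != 0 -> lodd k -> odd (m k + (m k).-1).
Proof.
rewrite /cre_coef => + ok; rewrite ok; case: (m k) => [|n].
  by rewrite mul0r eqxx.
by rewrite addSn /= addnn odd_double.
Qed.

Lemma ann_odd k m : ann_coef k m != 0 -> lodd k -> odd (m k + (m k).+1).
Proof. by rewrite addnS /= addnn odd_double. Qed.

Lemma occ_scaleE a (f : occ_space) m : (a *: f) m = a * f m. Proof. by []. Qed.

Lemma occ_addE (f h : occ_space) m : (f + h) m = f m + h m. Proof. by []. Qed.

Lemma cre_cre i j f : cre i (cre j f) = lsign i j *: cre j (cre i f).
Proof.
apply/funext => m; rewrite occ_scaleE /cre.
have [->|ij] := eqVneq i j.
  rewrite /lsign; case oj: (lodd j); last by rewrite expr0 mul1r.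
  suff -> : cre_coef j m * (cre_coef j (upd m j (m j).-1) * f (upd (upd m j (m j).-1) j
     (upd m j (m j).-1 j).-1)) = 0 by rewrite mulr0.
  rewrite mulrA /cre_coef oj updE; case: (m j) => [|n] /=; first by rewrite !mul0r.
  by case: (odd n); rewrite /= ?mul0r ?mulr0 ?mul0r.
have ji : j != i by rewrite eq_sym.
rewrite !(upd_neq _ _ ij) !(upd_neq _ _ ji) (updC _ _ _ ij) !mulrA; congr (_ * _).
by rewrite (coef_comm (di := predn) (dj := predn)) ?mulrA //;
  [exact: cre_odd | exact: cre_odd | exact: cre_coefE | exact: cre_coefE].
Qed.

Lemma ann_ann i j f : ann i (ann j f) = lsign i j *: ann j (ann i f).
Proof.
apply/funext => m; rewrite occ_scaleE /ann.
have [->|ij] := eqVneq i j.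
  rewrite /lsign; case oj: (lodd j); last by rewrite expr0 mul1r.
  suff -> : ann_coef j m * (ann_coef j (upd m j (m j).+1) * f (upd (upd m j (m j).+1) j
     (upd m j (m j).+1 j).+1)) = 0 by rewrite mulr0.
  rewrite mulrA /ann_coef oj updE /=.
  by case: (odd (m j)); rewrite /= ?mul0r ?mulr0 ?mul0r.
have ji : j != i by rewrite eq_sym.
rewrite !(upd_neq _ _ ij) !(upd_neq _ _ ji) (updC _ _ _ ij) !mulrA; congr (_ * _).
by rewrite (coef_comm (di := succn) (dj := succn)) ?mulrA //;
  [exact: ann_odd | exact: ann_odd | exact: ann_coefE | exact: ann_coefE].
Qed.

(** At i = j the even case is (n + 1) - n = 1 times [kappa]; in the odd case exactly one of the two
    orders survives, according to the parity of the occupation number. *)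
Lemma ann_cre i j f : ann i (cre j f) =
  lsign i j *: cre j (ann i f) + ((i == j)%:R * kappa i) *: f.
Proof.
apply/funext => m.
rewrite occ_addE !occ_scaleE /ann /cre.
have [->|ij] := eqVneq i j; last first.
  have ji : j != i by rewrite eq_sym.
  rewrite mul0r mul0r addr0.
  rewrite !(upd_neq _ _ ij) !(upd_neq _ _ ji) (updC _ _ _ ij) !mulrA; congr (_ * _).
  by rewrite (coef_comm (di := succn) (dj := predn)) ?mulrA //;
    [exact: ann_odd | exact: cre_odd | exact: ann_coefE | exact: cre_coefE].
rewrite !updE !upd_upd /= upd_id mul1r /lsign /ann_coef /cre_coef !updE /kappa.
case oj: (lodd j).
  rewrite !msign_upd ltnn andbF expr1 /=; have ss := msign_sq j m.
  case odd_mj: (odd (m j)) => /=; last by ring: ss.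
  have mj : (m j).-1.+1 = m j by case: (m j) odd_mj.
  have -> : odd (m j).-1 = false by rewrite -mj /= in odd_mj; exact: negbTE.
  by rewrite mj upd_id /=; ring: ss.
case mj: (m j) => [|n] /=; first by ring.
by rewrite -mj upd_id; ring.
Qed.

Definition odual (a : osc) : osc :=
  match a with Oc => Od | Od => Oc | Opsip => Opsim | Opsim => Opsip end.

(** * The oscillator representation on occupation numbers *)

Variable gamma : cd_space K.

Definition zero_mode (a : osc) : K :=
  match a with
  | Oc => cd_form (vec_c K) gamma
  | Od => cd_form (vec_d K) gamma
  | _ => 0
  end.

(** A fermionic mode n >= 0 pairs with the dual mode -n - 1, which is letter n; a bosonic mode n > 0
    pairs with the dual mode -n, which is letter n - 1. *)
Definition occ_mode (a : osc) (n : int) (f : occ_space) : occ_space :=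
  if n < 0 then cre (osc_letter a (absz n).-1) f
  else if osc_odd a then ann (osc_letter (odual a) (absz n)) f
  else if n == 0 then zero_mode a *: f
  else ann (osc_letter (odual a) (absz n).-1) f.

Definition occ_op (b : heis_cliff K) (f : occ_space) : occ_space :=
  if b is Osc a n then occ_mode a n f else f.

Lemma cre_lin i : linear (cre i).
Proof.
move=> a f h; apply/funext => m.
by rewrite occ_addE occ_scaleE /cre occ_addE occ_scaleE; ring.
Qed.

Lemma ann_lin i : linear (ann i).
Proof.
move=> a f h; apply/funext => m.
by rewrite occ_addE occ_scaleE /ann occ_addE occ_scaleE; ring.
Qed.

Lemma occ_op_lin b : linear (occ_op b).
Proof.
case: b => [a n|] c f h; last by [].
rewrite /= /occ_mode; case: ifP => _; first exact: cre_lin.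
case: ifP => _; first exact: ann_lin.
case: ifP => _; last exact: ann_lin.
by lmod_split; ring.
Qed.

Lemma lsign_letter a b k l : lsign (osc_letter a k) (osc_letter b l) = osign K a b.
Proof. by rewrite /lsign /lodd !osc_letterK. Qed.

Lemma eq_osc_letter a b k l :
  (osc_letter (odual a) k == osc_letter b l) = opaired a b && (k == l).
Proof.
by case: a; case: b; rewrite /osc_letter /=; lia.
Qed.

Lemma kappa_letter a k : kappa (osc_letter (odual a) k) =
  if osc_odd a then 1 else 2 * k.+1%:R.
Proof.
rewrite /kappa /lodd osc_letterK osc_letter_div.
by case: a.
Qed.

Lemma occ_ann_cre a b k l f :
  ann (osc_letter (odual a) k) (cre (osc_letter b l) f) =
  osign K a b *: cre (osc_letter b l) (ann (osc_letter (odual a) k) f)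
  + ((opaired a b && (k == l))%:R * (if osc_odd a then 1 else 2 * k.+1%:R)) *: f.
Proof.
rewrite ann_cre lsign_letter eq_osc_letter kappa_letter.
by congr (_ *: _ + _); case: a; case: b.
Qed.

Lemma obracketC a b m n : obracket K a b m n = - osign K a b * obracket K b a n m.
Proof.
rewrite !obracketE (addrC n m) /osign; case: a; case: b => /=;
  rewrite ?mul0r ?mulr0 // /ocoef /oshift /= ?addr0; try by ring.
all: rewrite /kdelta; case: eqP => [mn|_]; last by rewrite !mulr0.
all: by have -> : n = - m by [lia]; ring.
Qed.

Lemma occ_mode_comm a b m n f : occ_mode a m (occ_mode b n f) =
  osign K a b *: occ_mode b n (occ_mode a m f) + obracket K a b m n *: f.
Proof.
have dualE c d : osign K (odual c) (odual d) = osign K c d by case: c; case: d.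
(* The only case in which the bracket can be nonzero, up to exchanging the two modes. *)
have key c d i j h : 0 <= i -> j < 0 -> occ_mode c i (occ_mode d j h) =
    osign K c d *: occ_mode d j (occ_mode c i h) + obracket K c d i j *: h.
  move=> i0 j0; rewrite /occ_mode j0 (ltNge i) i0 /= obracketE /ocoef /oshift.
  case codd: (osc_odd c).
    rewrite occ_ann_cre codd mulr1; congr (_ + _ *: _).
    have [cd|] := boolP (opaired c d); last by rewrite !mul0r.
    have -> : osc_odd d by move: codd cd; case: c; case: d.
    by rewrite mulr1 mul1r /kdelta; congr (nat_of_bool _)%:R; apply/eqP/eqP; lia.
  have [i_0|i_0] := eqVneq i 0.
    rewrite (linZ (cre_lin _)) /osign codd expr0 scale1r.
    suff -> : (opaired c d)%:R * (if osc_odd d then 1 else 2 * i%:~R) *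
      kdelta K (i + j + osc_odd d) = 0 by rewrite scale0r addr0.
    rewrite i_0; case: ifP => [dodd|_]; last by ring.
    by move: codd dodd; case: c => //; case: d => // *; rewrite !mul0r.
  rewrite occ_ann_cre codd; congr (_ + _ *: _).
  have [cd|] := boolP (opaired c d); last by rewrite !mul0r.
  have -> : osc_odd d = false by move: codd cd; case: c; case: d.
  have -> : ((absz i).-1.+1)%:R = i%:~R :> K.
    by rewrite prednK ?pmulrn; [congr (_%:~R); lia | lia].
  have -> : true && ((absz i).-1 == (absz j).-1) = (i + j + false == 0) by lia.
  by rewrite mulrC mul1r.
have [m0|m0] := ltrP m 0; have [n0|n0] := ltrP n 0.
- rewrite obracket_same_side ?m0 ?n0 // scale0r addr0 /occ_mode m0 n0.
  by rewrite cre_cre lsign_letter.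
- rewrite (key b a n m) // (obracketC a b) (osignC K b a) scalerDr !scalerA osignK.
  by rewrite scale1r mulNr scaleNr addrK.
- exact: key.
- rewrite obracket_same_side ?(ltNge m) ?(ltNge n) ?m0 ?n0 // scale0r addr0.
  have zlin c h : osc_odd c = false -> linear (occ_mode c h).
    by move=> _; exact: (occ_op_lin (Osc c h : heis_cliff K)).
  rewrite /occ_mode !(ltNge m) !(ltNge n) m0 n0 /=.
  case aodd: (osc_odd a); case bodd: (osc_odd b).
  + by rewrite ann_ann lsign_letter dualE.
  + rewrite /osign bodd andbF expr0 scale1r; case: ifP => _.
      by rewrite (linZ (ann_lin _)).
    by rewrite ann_ann lsign_letter dualE /osign bodd andbF scale1r.
  + rewrite /osign aodd expr0 scale1r; case: ifP => _.
      by rewrite (linZ (ann_lin _)).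
    by rewrite ann_ann lsign_letter dualE /osign aodd scale1r.
  + rewrite /osign aodd expr0 scale1r; case: ifP => _; case: ifP => _.
    * by rewrite !scalerA mulrC.
    * by rewrite (linZ (ann_lin _)).
    * by rewrite (linZ (ann_lin _)).
    * by rewrite ann_ann lsign_letter dualE /osign aodd scale1r.
Qed.

Definition occ_vac : occ_space := fun m => `[< forall i, m i = 0%N >]%:R.

Lemma ann_vac i : ann i occ_vac = 0.
Proof.
apply/funext => m; rewrite /ann /occ_vac.
case: asboolP => [/(_ i)|_]; last by rewrite mulr0.
by rewrite updE.
Qed.

Lemma occ_op_vac b x : fock_hw gamma b = Some x -> occ_op b occ_vac = x *: occ_vac.
Proof.
case: b => [a n|] /=; last by case=> <-; rewrite scale1r.
rewrite /occ_mode; case: (ltrgtP n 0) => // n0.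
  by case=> <-; case: ifP => _; rewrite ann_vac scale0r.
by case: a => [] [<-] /=; rewrite ?ann_vac ?scale0r.
Qed.

Lemma occ_op_bracket (a b : heis_cliff K) f :
  occ_op a (occ_op b f) - ssign a b *: occ_op b (occ_op a f) =
  \sum_(t <- sbracket a b) t.1 *: occ_op t.2 f.
Proof.
rewrite /ssign; case: a => [a m|]; case: b => [b n|] /=.
- rewrite occ_mode_comm addrAC subrr add0r.
  by case: a; case: b => /=; rewrite ?scale0r ?big_nil ?big_seq1.
- by rewrite andbF scale1r subrr; case: a; rewrite big_nil.
- by rewrite scale1r subrr big_nil.
- by rewrite scale1r subrr big_nil.
Qed.

Lemma fock_occupation : exists f : fock gamma -> occ_space, [/\ linear f,
  forall b x, f (act b x) = occ_op b (f x) & f (hwgen (fock_hw gamma)) = occ_vac].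
Proof.
apply: (hwmod_eval (@fock_hw_odd K gamma) occ_op_lin occ_op_bracket) => b x.
exact: occ_op_vac.
Qed.

(** * Coordinates of oscillator words *)

Definition fock_letter (i : nat) : heis_cliff K :=
  Osc (letter_osc i) (- (i %/ 4)%:Z - 1).

Lemma occ_op_letter i f : occ_op (fock_letter i) f = cre i f.
Proof.
rewrite /= /occ_mode; have -> : - (i %/ 4)%:Z - 1 < 0 by lia.
have -> : (absz (- (i %/ 4)%:Z - 1)%R).-1 = (i %/ 4)%N by lia.
by rewrite letter_oscK.
Qed.

Variables (M : srep (heis_cliff K)) (v : M) (f : M -> occ_space).
Hypotheses (f_act : forall b x, f (act b x) = occ_op b (f x)) (f_vac : f v = occ_vac).

Definition fock_word (s : seq nat) : M := wact (map fock_letter s) v.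

(** Each creation operator raises one occupation number by one, starting from the vacuum. *)
Lemma fock_word_support s m :
  f (fock_word s) m != 0 -> forall i, m i = count_mem i s.
Proof.
elim: s m => [|j s IH] m.
  rewrite /fock_word /= f_vac /occ_vac; case: asboolP => [m0 _ i|_].
    by rewrite m0.
  by rewrite eqxx.
rewrite /fock_word /= f_act occ_op_letter /cre.
have [->|c0] := eqVneq (cre_coef j m) 0; first by rewrite mul0r eqxx.
rewrite mulf_eq0 (negPf c0) => /IH ms i /=; rewrite -ms /upd.
have [->|ij] := eqVneq i j; last by [].
rewrite add1n prednK //; move: c0; rewrite /cre_coef.
by case: (m j) => //; case: ifP; rewrite ?mul0r eqxx.
Qed.

(** In an ordered word an odd letter is not repeated, so its occupation number is 1 and its creation
    coefficient is a sign; for an even letter that coefficient is 1. *)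
Lemma fock_word_coef s : ordered fock_letter s ->
  f (fock_word s) (fun i => count_mem i s) != 0.
Proof.
elim: s => [_|j s IH].
  by rewrite /fock_word /= f_vac /occ_vac; case: asboolP => [_|[]//]; exact: oner_neq0.
rewrite /ordered /= => /andP[js /IH {}IH].
rewrite /fock_word /= f_act occ_op_letter /cre mulf_neq0 //.
  rewrite /cre_coef /= eqxx; case: ifP => oj; last by rewrite add1n oner_neq0.
  have /count_memPn -> : j \notin s.
    apply/negP => /(allP js); rewrite /letter_le ltnn eqxx /=.
    by rewrite -[osc_odd _]/(lodd j) oj.
  rewrite mul1r; apply: contraTneq (oner_neq0 K) => s0.
  by rewrite -(msign_sq j (fun i => count_mem i (j :: s))) s0 mul0r eqxx.
rewrite [upd _ _ _](_ : _ = fun i => count_mem i s) //.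
apply/funext => i; rewrite /upd /= eqxx.
by have [->|] := eqVneq i j; rewrite // eq_sym => /negPf ->.
Qed.

End Occupation.

(** * The weight filtration *)

Lemma hwmod_ind (K : fieldType) (g : superlie K) (hw : g -> option K)
    (P : hwmod hw -> Prop) :
  P (hwgen hw) -> P 0 -> (forall x y, P x -> P y -> P (x + y)) ->
  (forall a x, P x -> P (a *: x)) -> (forall b x, P x -> P (act b x)) ->
  forall x, P x.
Proof.
move=> Pgen P0 PD PZ Pact; elim/hwspace_ind.
elim=> [||x Px y Py|a x Px|b x Px] //.
- by rewrite hwclsD; exact: PD.
- by rewrite hwclsZ; exact: PZ.
- by rewrite -hwactE; exact: Pact.
Qed.

(** * The Fock module as a cyclic module over the oscillators *)

Section Fock.
Variables (K : numClosedFieldType) (gamma : cd_space K).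
Variables (M : srep (heis_cliff K)) (vac : M).
Hypotheses (M_mod : is_module M) (M_hwv : is_hwv (fock_hw gamma) vac)
  (M_ind : forall P : M -> Prop, P vac -> P 0 ->
    (forall x y, P x -> P y -> P (x + y)) -> (forall a x, P x -> P (a *: x)) ->
    (forall b x, P x -> P (act b x)) -> forall x, P x).
Local Notation mode := (@mode K M).

Let actL b := act_lin M_mod b.

Lemma fock_level (x : M) : act (OscK : heis_cliff K) x = x.
Proof.
elim/M_ind: x => [||x y xE yE|a x xE|b x xE].
- rewrite (proj2 M_hwv OscK 1) //.
  by rewrite scale1r.
- exact: lin0 (actL _).
- by rewrite (linD (actL _)) xE yE.
- by rewrite (linZ (actL _)) xE.
- have := act_bracket M_mod (OscK : heis_cliff K) b x.
  by rewrite /ssign /= expr0 scale1r big_nil xE => /eqP; rewrite subr_eq0 => /eqP.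
Qed.

Lemma mode_vac a (n : int) : 0 <= n ->
  mode a n vac = (if n == 0 then zero_mode gamma a else 0) *: vac.
Proof.
move=> n0; apply: (proj2 M_hwv (Osc a n : heis_cliff K)).
rewrite /= ltNge; case: (ltrgtP n 0) n0 => //= n0 _.
by case: a.
Qed.

Lemma fock_smooth : @smooth K M.
Proof.
elim/M_ind => [||x y [T HT] [T' HT']|a x [T HT]|b x [T HT]].
- exists 1%N => a n n1; rewrite mode_vac; last by lia.
  have -> : (n == 0) = false by lia.
  by rewrite scale0r.
- by exists 0%N => a n _; exact: lin0 (actL _).
- exists (maxn T T') => a n nT; rewrite (modeE M_mod).
  by rewrite HT ?HT' ?addr0 //; lia.
- by exists T => a' n nT; rewrite (modeE M_mod) HT ?scaler0.
- case: b => [b m|]; last by exists T => a n nT; rewrite fock_level HT.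
  exists (T + absz m).+1 => a n nT; rewrite -/(mode b m x).
  rewrite (mode_comm M_mod fock_level) HT; last by lia.
  rewrite (lin0 (mode_lin M_mod _ _)) scaler0 add0r obracketE /kdelta.
  have -> : (n + m + oshift b == 0) = false by rewrite /oshift; lia.
  by rewrite mulr0 scale0r.
Qed.

(** The factor m in the bracket of c(m) with d(n) vanishes at m = 0, so c(0) commutes with all
    modes. *)
Lemma mode_c0 (x : M) : mode Oc 0 x = zero_mode gamma Oc *: x.
Proof.
elim/M_ind: x => [||x y xE yE|a x xE|b x xE].
- by rewrite mode_vac.
- by rewrite (lin0 (mode_lin M_mod _ _)) scaler0.
- by rewrite (modeE M_mod) xE yE scalerDr.
- by rewrite (modeE M_mod) xE !scalerA mulrC.
- case: b => [b n|]; last by rewrite fock_level xE.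
  rewrite -/(mode b n x) (mode_comm M_mod fock_level) xE (modeE M_mod).
  rewrite /osign expr0 scale1r; case: b; rewrite /obracket ?scale0r ?addr0 //.
  by rewrite mulr0z mulr0 mul0r scale0r addr0.
Qed.

(** An annihilation mode gets minus the weight of the creation mode it removes. The offsets place
    d(-n) strictly between Psi^+(-n+1/2) and Psi^+(-n-1/2), as the mixed terms of L and G
    require. *)
Definition mode_weight (a : osc) (n : int) : int :=
  match a with
  | Oc => if 0 < n then - (2 * n + 2) else 0
  | Od => if n < 0 then - (2 * n) + 2 else 0
  | Opsip => if n < 0 then - (2 * n) + 1 else 0
  | Opsim => if n < 0 then 0 else - (2 * n + 3)
  end.

Definition letter_weight (i : nat) : int :=
  mode_weight (letter_osc i) (- (i %/ 4)%:Z - 1).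

Definition word_weight (s : seq nat) : int := \sum_(i <- s) letter_weight i.

Lemma word_weight_cons i s : word_weight (i :: s) = letter_weight i + word_weight s.
Proof. exact: big_cons. Qed.

Definition weight_le (N : int) : M -> Prop :=
  spanned (fun x => exists s, word_weight s <= N /\ x = fock_word vac s).

Lemma letter_weight_ge0 i : 0 <= letter_weight i.
Proof.
by rewrite /letter_weight /mode_weight; case: (letter_osc i); case: ifP; lia.
Qed.

Lemma word_weight_ge0 s : 0 <= word_weight s.
Proof. by rewrite /word_weight; apply: sumr_ge0 => i _; exact: letter_weight_ge0. Qed.

Lemma weight_le_trans N N' x : N <= N' -> weight_le N x -> weight_le N' x.
Proof.
move=> NN'; apply: spanned_bind => y [s [sN ->]]; apply: spanned_in.
by exists s; split=> //; exact: le_trans NN'.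
Qed.

Lemma weight_le_letter N i x :
  weight_le N x -> weight_le (N + letter_weight i) (act (fock_letter K i) x).
Proof.
apply: spanned_lin => [|y [s [sN ->]]]; first exact: actL.
apply: spanned_in; exists (i :: s); split=> //.
by rewrite /word_weight big_cons addrC lerD2r.
Qed.

Lemma mode_letter a (n : int) x : n < 0 ->
  mode a n x = act (fock_letter K (osc_letter a (absz n).-1)) x.
Proof.
move=> n0; rewrite /fock_letter osc_letterK osc_letter_div.
by congr (act (Osc a _ : heis_cliff K) x); lia.
Qed.

(** A creation mode adds a letter. An annihilation mode is commuted to the vacuum, and each nonzero
    bracket deletes a letter of exactly the opposite weight. *)
Lemma weight_le_mode N a n x :
  weight_le N x -> weight_le (N + mode_weight a n) (mode a n x).
Proof.
apply: spanned_lin => [|y [s [sN ->]]]; first exact: actL.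
apply: (@weight_le_trans (word_weight s + mode_weight a n)); first by rewrite lerD2r.
have [n0|n0] := ltrP n 0.
  rewrite mode_letter //; have -> : mode_weight a n =
      letter_weight (osc_letter a (absz n).-1).
    by rewrite /letter_weight osc_letterK osc_letter_div; congr mode_weight; lia.
  by apply/weight_le_letter/spanned_in; exists s.
elim: s {N sN y} => [|i s IH].
  rewrite /word_weight big_nil add0r -[fock_word vac [::]]/vac mode_vac //.
  case: eqP => [n_0|_]; last by rewrite scale0r; left.
  (* At n = 0 only Psi^- has negative weight, and it kills the vacuum. *)
  have [a_psi|wt] : a = Opsim \/ 0 <= mode_weight a n.
    by rewrite n_0; case: a; [right|right|right|left].
  - by rewrite a_psi scale0r; left.
  - by apply/spannedZ/spanned_in; exists [::]; rewrite /word_weight big_nil.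
rewrite /fock_word /= -/(fock_word vac s) /fock_letter -/(mode (letter_osc i) _ _).
rewrite (mode_comm M_mod fock_level).
have -> : word_weight (i :: s) + mode_weight a n =
    word_weight s + mode_weight a n + letter_weight i.
  by rewrite word_weight_cons; ring.
apply: spannedD; first exact/spannedZ/weight_le_letter.
have [->|br0] := eqVneq (obracket K a (letter_osc i) n (- (i %/ 4)%:Z - 1)) 0.
  by rewrite scale0r; left.
apply/spannedZ/spanned_in; exists s; split=> //.
move: br0; rewrite -addrA lerDl obracketE /letter_weight.
set j := _ - 1; have [e|ne] := eqVneq (n + j + oshift (letter_osc i)) 0; last first.
  by rewrite kdelta0 // mulr0 eqxx.
have [ab|] := boolP (opaired a (letter_osc i)); last by rewrite !mul0r eqxx.
move=> _; have j0 : j < 0 by rewrite /j; lia.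
move: e ab; rewrite /mode_weight /oshift; case: a {IH}; case: (letter_osc i) => //=;
  do 2?[case: ifP]; lia.
Qed.

Transparent quad nop.

Lemma weight_le_quad N a b (f : int -> K) k B x :
    (forall i, f i = 0 \/ mode_weight a i + mode_weight b (k - i) <= B) ->
  weight_le N x -> weight_le (N + B) (quad 0 a b f k x).
Proof.
move=> fB Nx; have [T FT] := nop_fin_supp M_mod fock_smooth 0 a b f k x.
rewrite /quad (zsumE FT); apply: spanned_sum => i _.
have [->|abB] := fB i; first by rewrite scale0r; left.
apply/spannedZ/(weight_le_trans (N := N + (mode_weight a i + mode_weight b (k - i)))).
  by rewrite lerD2l.
rewrite /nop; case: ifP => _.
  by rewrite (addrC (mode_weight a i)) addrA; do 2!apply: weight_le_mode.
by apply: spannedZ; rewrite addrA; do 2!apply: weight_le_mode.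
Qed.

(** The summand with c(0) is split off because it alone keeps the full weight; it feeds the leading
    coefficient. *)
Lemma quad_c0 b k x : quad 0 Oc b (fun=> 1) k x =
  zero_mode gamma Oc *: mode b k x + quad 0 Oc b (fun i => (i != 0)%:R) k x.
Proof.
rewrite (@eq_quad _ _ _ _ _ _ (fun i => (i == 0)%:R + (i != 0)%:R)) => [|i]; last first.
  by case: eqP; rewrite ?addr0 ?add0r.
rewrite quadD //; last exact: fock_smooth.
congr (_ + _); rewrite /quad (zsum1 (i0 := 0)) => [|i /negPf ->]; last first.
  by rewrite scale0r.
by rewrite eqxx scale1r subr0 /nop ltxx osign_even // scale1r mode_c0 (modeE M_mod).
Qed.

(** Only i = 0 can survive on the vacuum. The bound allows k = -1 for two fermions, since they enter
    L(n) with total index n - 1. *)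
Lemma quad_vac a b (f : int -> K) (k : int) : - (osc_odd a && osc_odd b)%:Z <= k ->
  quad 0 a b f k vac =
  (f 0 * osign K a b * zero_mode gamma a
    * (if k == 0 then zero_mode gamma b else 0)) *: vac.
Proof.
move=> k0; have za c : osc_odd c -> zero_mode gamma c = 0 by case: c.
rewrite /quad (zsum1 (i0 := 0)) => [|i i0].
  rewrite subr0 /nop ltxx mode_vac // eqxx (modeE M_mod).
  have [a1|a0] := boolP (osc_odd a).
    by rewrite za // !(scale0r, scaler0, mulr0, mul0r).
  rewrite (negPf a0) /= oppr0 in k0.
  by rewrite mode_vac // !scalerA; congr (_ *: _); ring.
rewrite /nop; case: ifP => i_neg.
  rewrite mode_vac; last by move: k0; case: (_ && _); lia.
  case: eqP => [ki|_]; last by rewrite scale0r (lin0 (mode_lin M_mod _ _)) scaler0.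
  have /andP[_ /za ->] : osc_odd a && osc_odd b by move: k0; case: (_ && _) => //; lia.
  by rewrite scale0r (lin0 (mode_lin M_mod _ _)) scaler0.
rewrite mode_vac; last by lia.
by rewrite (negPf i0) scale0r (lin0 (mode_lin M_mod _ _)) !scaler0.
Qed.

Opaque quad nop.

(** * The highest weight vector and the leading terms of SH modes *)

Variables (cL cLa p r : K).
Hypothesis gammaE : gamma = - ((p + 1) / 2) *: dbar cL + r *: vec_c K.

Lemma scale_regular (a b : K) : a *: (b : K^o) = a * b. Proof. by []. Qed.

Lemma zero_mode_c : zero_mode gamma Oc = - (p + 1).
Proof. by rewrite gammaE /= /cd_form /= !scale_regular; field. Qed.

Lemma zero_mode_d : zero_mode gamma Od = (p + 1) * ((cL - 3) / 12) + 2 * r.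
Proof. by rewrite gammaE /= /cd_form /= !scale_regular; field. Qed.

Local Notation fact := (@free_field_act K cL cLa M).
Local Notation q := (sqrtC 2 : K).
Let ffE := (free_field_L M_mod fock_smooth, free_field_G M_mod fock_smooth,
  free_field_alpha M_mod, free_field_psi M_mod).

Lemma free_field_hwv : @is_hwv K (SH K) (verma_hw cL cLa (h_pr cL p r) ((1 + p) * cLa))
  (free_field cL cLa M) vac.
Proof.
split; first exact: proj1 M_hwv.
suff : forall b x, verma_hw cL cLa (h_pr cL p r) ((1 + p) * cLa) b = Some x ->
  fact b vac = x *: vac by [].
move=> b x; case: b => [n|n|n|n|||]; rewrite /verma_hw.
- case: (ltrgtP n 0) => // n0 [<-]; rewrite ffE /Lop.
    rewrite !quad_vac //=; try by lia.
    rewrite !mode_vac; try by lia.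
    have -> : (n == 0) = false by lia.
    by lmod_split; ring.
  (* L(0) gives (c(0) + 1) d(0)/2 - A c(0)/2 with A = (c_L - 3)/12; inserting c(0) = -(p + 1) and
     d(0) = (p + 1) A + 2 r yields h_{p,r}. *)
  rewrite n0 !quad_vac ?mode_vac ?eqxx ?zero_mode_c ?zero_mode_d
    ?(@osign_even K Oc) //= /h_pr.
  by lmod_split; field.
- case: (ltrgtP n 0) => // n0 [<-]; rewrite ffE mode_vac; try by lia.
    have -> : (n == 0) = false by lia.
    by lmod_split; ring.
  by rewrite n0 eqxx zero_mode_c; lmod_split; ring.
- case: ifP => // n0 [<-]; rewrite ffE /Gop !quad_vac //= !mode_vac //=.
  by rewrite !if_same; lmod_split; ring.
- case: ifP => // n0 [<-]; rewrite ffE mode_vac //= if_same.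
  by rewrite !scale0r scaler0.
- by case=> <-.
- by case=> <-; rewrite scale0r.
- by case=> <-.
Qed.

(** Each SH creation mode carries the number of its leading oscillator mode, so that the same lists
    index words of both kinds. *)
Definition sh_letter (i : nat) : SH K :=
  let n := - (i %/ 4)%:Z - 1 in
  match letter_osc i with
  | Oc => Salpha n | Od => SL n | Opsip => SG n | Opsim => SPsi n
  end.

Definition lead_coef_letter (i : nat) : K :=
  let n := - (i %/ 4)%:Z - 1 in
  match letter_osc i with
  | Oc => - cLa
  | Od => (n%:~R - p) / 2
  | Opsip => q * ((n + 1)%:~R - (p + 1) / 2)
  | Opsim => - (q * cLa)
  end.

(** The coefficient of L(n) vanishes at p = n and that of G(n + 1/2) at p = 2n + 1, both negative
    integers when n < 0. *)
Lemma lead_coef_letter_neq0 i : cLa != 0 -> (forall n : int, n < 0 -> p != n%:~R) ->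
  lead_coef_letter i != 0.
Proof.
move=> cLa0 hp; have q0 : q != 0 by rewrite sqrtC_eq0 pnatr_eq0.
have two0 : (2 : K) != 0 by rewrite pnatr_eq0.
rewrite /lead_coef_letter; set n := _ - 1; case: (letter_osc i).
- by rewrite oppr_eq0.
- by rewrite mulf_neq0 ?invr_neq0 // subr_eq0 eq_sym hp // /n; lia.
- rewrite mulf_neq0 // subr_eq0; apply/eqP => np.
  have /eqP [] : p != (2 * n + 1)%:~R by apply: hp; rewrite /n; lia.
  have : (n + 1)%:~R * 2 = p + 1 by rewrite np mulfVK.
  by move=> np2; have -> : p = p + 1 - 1 by [ring]; rewrite -np2; ring.
- by rewrite oppr_eq0 mulf_neq0.
Qed.

Transparent Lop Gop.

(* Modulo terms of smaller weight, an SH creation mode is a nonzero multiple of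
   the corresponding oscillator mode; the coefficient collects the c(0) part of
   the quadratic terms and the background charge. *)
Lemma free_field_letter N i x : weight_le N x ->
  weight_le (N + letter_weight i - 1)
    (fact (sh_letter i) x - lead_coef_letter i *: act (fock_letter K i) x).
Proof.
move=> Nx; rewrite /sh_letter /lead_coef_letter /fock_letter /letter_weight.
set n := - (i %/ 4)%:Z - 1; have n0 : n < 0 by rewrite /n; lia.
rewrite -/(mode (letter_osc i) n x); case: (letter_osc i); rewrite ffE /=.
- by rewrite subrr; left.
- have -> : Lop cL n x - ((n%:~R - p) / 2) *: mode Od n x =
      (1 / 2) *: quad 0 Oc Od (fun i => (i != 0)%:R) n x
      - ((n + 1)%:~R / 2 * ((cL - 3) / 12)) *: mode Oc n x
      + (1 / 2) *: quad 0 Opsip Opsim (fun i => - i%:~R - 1) (n - 1) x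
      + (1 / 2) *: quad 0 Opsim Opsip (fun i => - i%:~R - 1) (n - 1) x.
    by rewrite /Lop quad_c0 zero_mode_c; lmod_split; field.
  rewrite -addrA n0.
  apply: spannedD; first apply: spannedD; first apply: spannedB.
  + apply/spannedZ/weight_le_quad => // j.
    have [->|j0] := eqVneq j 0; [by left|right]; rewrite /mode_weight.
    by do 2?[case: ifP]; lia.
  + apply/spannedZ/(weight_le_trans (N := N + mode_weight Oc n)).
      by rewrite lerD2l /mode_weight; case: ifP; lia.
    exact: weight_le_mode.
  + apply/spannedZ/weight_le_quad => // j; right; rewrite /mode_weight.
    by do 2?[case: ifP]; lia.
  + apply/spannedZ/weight_le_quad => // j; right; rewrite /mode_weight.
    by do 2?[case: ifP]; lia.
- have -> : Gop cL n x - (q * ((n + 1)%:~R - (p + 1) / 2)) *: mode Opsip n x =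
      (q / 2) *: quad 0 Oc Opsip (fun i => (i != 0)%:R) n x
      + (q / 2) *: quad 0 Od Opsim (fun=> 1) n x
      - (q * (cL - 3) / 12 * (n + 1)%:~R) *: mode Opsim n x.
    by rewrite /Gop quad_c0 zero_mode_c; lmod_split; field.
  rewrite -addrA n0.
  apply: spannedB; first apply: spannedD.
  + apply/spannedZ/weight_le_quad => // j.
    have [->|j0] := eqVneq j 0; [by left|right]; rewrite /mode_weight.
    by do 2?[case: ifP]; lia.
  + apply/spannedZ/weight_le_quad => // j; right; rewrite /mode_weight.
    by do 2?[case: ifP]; lia.
  + apply/spannedZ/(weight_le_trans (N := N + mode_weight Opsim n)).
      by rewrite lerD2l /mode_weight; case: ifP; lia.
    exact: weight_le_mode.
- by rewrite subrr; left.
Qed.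

Opaque Lop Gop.

Lemma weight_le_exists x : exists N, weight_le N x.
Proof.
elim/M_ind: x => [||x y [N Nx] [N' Ny]|a x [N Nx]|b x [N Nx]].
- by exists 0; apply: spanned_in; exists [::]; rewrite /word_weight big_nil.
- by exists 0; left.
- exists (Num.max N N'); apply: spannedD.
    by apply: weight_le_trans Nx; rewrite le_max lexx.
  by apply: weight_le_trans Ny; rewrite le_max lexx orbT.
- by exists N; apply: spannedZ.
- case: b => [a n|]; last by exists N; rewrite fock_level.
  by exists (N + mode_weight a n); exact: weight_le_mode.
Qed.

(** * Bijectivity of the canonical map *)

Variables (V : srep (SH K)) (v : V) (f : V -> M).
Hypotheses (V_mod : is_module V) (f_lin : linear f) (fv : f v = vac)
  (f_act : forall b x, f (act b x) = fact b (f x)).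
Hypotheses (cLa0 : cLa != 0) (hp : forall n : int, n < 0 -> p != n%:~R).

Definition sh_word (s : seq nat) : V := wact (map sh_letter s) v.

Definition lead_coef_word (s : seq nat) : K := \prod_(i <- s) lead_coef_letter i.

Lemma lead_coef_word_neq0 s : lead_coef_word s != 0.
Proof.
apply: (big_ind (fun c : K => c != 0)) => [|c d c0 d0|i _]; first exact: oner_neq0.
  by rewrite mulf_neq0.
exact: lead_coef_letter_neq0.
Qed.

(** Two errors arise from each new letter: its own lower terms, bounded by [free_field_letter], and
    its leading mode applied to the previous error. *)
Lemma sh_word_lead s :
  weight_le (word_weight s - 1) (f (sh_word s) - lead_coef_word s *: fock_word vac s).
Proof.
elim: s => [|i s IH].
  by rewrite /lead_coef_word big_nil scale1r [f _]fv subrr; left.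
have fs : weight_le (word_weight s) (f (sh_word s)).
  rewrite -[f _](subrK (lead_coef_word s *: fock_word vac s)); apply: spannedD.
    by apply: weight_le_trans IH; lia.
  by apply/spannedZ/spanned_in; exists s.
have -> : f (sh_word (i :: s)) = fact (sh_letter i) (f (sh_word s)) by exact: f_act.
rewrite /lead_coef_word big_cons -/(lead_coef_word s) -scalerA.
rewrite -[fact _ _](subrK (lead_coef_letter i *:
  act (fock_letter K i) (f (sh_word s)))).
rewrite -addrA -scalerBr; apply: spannedD.
  by rewrite word_weight_cons (addrC (letter_weight i)); exact: free_field_letter.
apply: spannedZ.
rewrite [fock_word _ (i :: s)]/(act (fock_letter K i) (fock_word vac s)).
have -> : act (fock_letter K i) (f (sh_word s))
      - lead_coef_word s *: act (fock_letter K i) (fock_word vac s) =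
    act (fock_letter K i) (f (sh_word s) - lead_coef_word s *: fock_word vac s).
  by rewrite (linD (actL _)) (linN (actL _)) (linZ (actL _)).
have -> : word_weight (i :: s) - 1 = word_weight s - 1 + letter_weight i.
  by rewrite word_weight_cons; ring.
exact: weight_le_letter.
Qed.

Lemma free_field_surj x : exists u, f u = x.
Proof.
have [N Nx] := weight_le_exists x.
(* With this offset k = 0 means weight at most -1, where only the zero vector lies. *)
have {N Nx} : exists k : nat, weight_le (k%:Z - 1) x.
  by exists (absz N).+1; apply: weight_le_trans Nx; lia.
case=> k; elim: k x => [|k IH] x; rewrite /weight_le.
  elim=> [|a y z [s [sN _]] _ _]; first by exists 0; exact: lin0.
  by have := word_weight_ge0 s; lia.
elim=> [|a y z [s [sN ->]] _ [u <-]]; first by exists 0; exact: lin0.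
have [u' u'E] : exists u', f u' = f (sh_word s) - lead_coef_word s *: fock_word vac s.
  by apply: IH; apply: weight_le_trans (sh_word_lead s); lia.
(* Subtracting the preimage [u'] of the error leaves exactly the leading multiple of the oscillator
   word. *)
exists ((a / lead_coef_word s) *: (sh_word s - u') + u).
rewrite f_lin (linD f_lin) (linN f_lin) u'E opprB addrCA subrr addr0.
by rewrite scalerA mulfVK // lead_coef_word_neq0.
Qed.

Variable phi : M -> occ_space K.
Hypotheses (phi_lin : linear phi) (phi_vac : phi vac = occ_vac K)
  (phi_act : forall b x, phi (act b x) = occ_op gamma b (phi x)).

Lemma sodd_sh_letter i : sodd (sh_letter i) = sodd (fock_letter K i).
Proof. by rewrite /sh_letter /=; case: (letter_osc i). Qed.

Lemma ordered_sh_letter s : ordered sh_letter s = ordered (fock_letter K) s.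
Proof.
by apply: eq_pairwise => i j; rewrite /letter_le sodd_sh_letter.
Qed.

Lemma ordered_count_inj (s t : seq nat) :
    ordered (fock_letter K) s -> ordered (fock_letter K) t ->
  (forall i, count_mem i s = count_mem i t) -> s = t.
Proof.
have ordS w : ordered (fock_letter K) w -> sorted leq w.
  rewrite (sorted_pairwise leq_trans); apply: sub_pairwise => i j.
  by rewrite /letter_le => /orP[/ltnW //|/andP[/eqP ->]].
move=> /ordS ss /ordS st st_count; apply: (sorted_eq leq_trans anti_leq ss st).
by apply/allP => i _; rewrite /= st_count.
Qed.

(** A nonzero coefficient at the occupation numbers of s would come from a permutation of s, which
    has the same weight as s. *)
Lemma weight_le_coef N x s : weight_le N x -> N < word_weight s ->
  phi x (fun i => count_mem i s) = 0.
Proof.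
move=> Nx Ns; elim: Nx => [|a y z [t [tN ->]] _ IH]; first by rewrite (lin0 phi_lin).
rewrite phi_lin occ_addE occ_scaleE IH addr0.
apply/eqP; rewrite mulf_eq0; apply/orP; right; apply: contraTT isT => nz.
have st : perm_eq s t.
  by apply/allP => i _; rewrite /= (fock_word_support phi_act phi_vac nz).
by move: Ns; rewrite /word_weight (perm_big _ st) ltNge; move: tN => ->.
Qed.

Lemma argmax_weight (l : seq (seq nat)) : l != [::] ->
  exists2 w, w \in l & forall t, t \in l -> word_weight t <= word_weight w.
Proof.
elim: l => [//|w l IH] _; have [->|/IH [u ul uM]] := eqVneq l [::].
  by exists w; rewrite ?inE // => t; rewrite inE => /eqP ->.
have [wu|uw] := lerP (word_weight w) (word_weight u).
  by exists u; rewrite ?inE ?ul ?orbT // => t; rewrite inE => /orP[/eqP ->|/uM].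
exists w; rewrite ?inE ?eqxx // => t; rewrite inE => /orP[/eqP -> //|/uM tu].
exact: le_trans tu (ltW uw).
Qed.

Lemma free_field_inj s :
    (forall t, t \in s -> ordered sh_letter t.2) ->
    f (\sum_(t <- s) t.1 *: sh_word t.2) = 0 ->
  \sum_(t <- s) t.1 *: sh_word t.2 = 0.
Proof.
move=> s_ord; pose ws := undup (map snd s).
pose c w := \sum_(t <- s | t.2 == w) t.1.
(* Equal words are merged, so that [c] holds their total coefficients. *)
have -> : \sum_(t <- s) t.1 *: sh_word t.2 = \sum_(w <- ws) c w *: sh_word w.
  under [RHS]eq_bigr do rewrite scaler_suml.
  rewrite (exchange_big_dep predT) //= big_seq [RHS]big_seq; apply: eq_bigr => t ts.
  rewrite -big_filter (_ : [seq w <- ws | t.2 == w] = [:: t.2]) ?big_seq1 //.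
  rewrite (eq_filter (a2 := pred1 t.2)) => [|w]; last by rewrite /= eq_sym.
  by rewrite filter_pred1_uniq ?undup_uniq // mem_undup map_f.
have ws_ord w : w \in ws -> ordered (fock_letter K) w.
  by rewrite mem_undup => /mapP[t /s_ord to ->]; rewrite -ordered_sh_letter.
rewrite (lin_sum f_lin) => f0.
(* Unless all coefficients vanish, a word w of maximal weight among those with nonzero coefficient
   leads to a contradiction. *)
have [l0|/argmax_weight [w]] := eqVneq [seq w <- ws | c w != 0] [::].
  apply: big1_seq => w /andP[_ wws]; apply/eqP; rewrite scaler_eq0; apply/orP; left.
  by apply: contraTT isT => cw; have := mem_filter (fun w => c w != 0) w ws;
    rewrite l0 cw wws.
rewrite mem_filter => /andP[cw wws] w_max.
have := congr1 (fun x => phi x (fun i => count_mem i w)) f0.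
rewrite (lin0 phi_lin) (lin_sum phi_lin) => coef0.
have {coef0} : \sum_(t <- ws) c t * phi (f (sh_word t)) (fun i => count_mem i w) = 0.
  rewrite -[RHS]coef0; elim: (ws) => [|t l IH]; first by rewrite !big_nil.
  by rewrite !big_cons occ_addE (linZ f_lin) (linZ phi_lin) occ_scaleE IH.
(* By maximality of w, the error terms of all words are too light to reach the occupation numbers of
   w. *)
have coefE t : t \in ws -> c t != 0 -> phi (f (sh_word t)) (fun i => count_mem i w) =
    lead_coef_word t * phi (fock_word vac t) (fun i => count_mem i w).
  move=> tws ct; have := sh_word_lead t.
  have tw : word_weight t - 1 < word_weight w.
    by rewrite ltrBlDr ltzD1; apply: w_max; rewrite mem_filter ct.
  move=> /weight_le_coef /(_ tw).
  rewrite (linD phi_lin) (linN phi_lin) (linZ phi_lin) => /eqP.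
  by rewrite subr_eq0 => /eqP.
rewrite (bigD1_seq w) ?undup_uniq //= big1_seq ?addr0 => [|t /andP[tw tws]].
  move=> /eqP; rewrite coefE // !mulf_eq0 (negPf cw) (negPf (lead_coef_word_neq0 w)) /=.
  by rewrite (negPf (fock_word_coef phi_act phi_vac (ws_ord w wws))).
have [->|ct] := eqVneq (c t) 0; first by rewrite mul0r.
rewrite coefE //; apply/eqP; rewrite !mulf_eq0; apply/orP; right; apply/orP; right.
(* An ordered word is determined by its occupation numbers, so only w itself contributes. *)
apply: contraNT tw => nz; apply/eqP/ordered_count_inj; rewrite ?ws_ord // => i.
by rewrite (fock_word_support phi_act phi_vac nz).
Qed.

End Fock.

(** * From the canonical map to the isomorphism *)

Lemma bijective_of_inj_surj (T U : Type) (f : T -> U) :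
  injective f -> (forall y, exists x, f x = y) -> bijective f.
Proof.
move=> f_inj f_surj; pose g y := sval (cid (f_surj y)).
have gK y : f (g y) = y by rewrite /g; case: cid.
by exists g => // x; apply: f_inj; rewrite gK.
Qed.

Lemma isomorphic_of_bij (K : fieldType) (g : superlie K) (M N : srep g)
    (f : {linear M -> N}) :
  is_module M -> is_module N -> is_hom f -> bijective f -> isomorphic N M.
Proof.
move=> M_mod N_mod [f_act f_par] [h hK fK]; split=> //.
have h_lin : linear h.
  by move=> a x y; apply: (can_inj hK); rewrite linearP !fK.
pose hL := GRing.isLinear.Build K N M *:%R h h_lin.
pose H : {linear N -> M} := HB.pack h hL.
exists H; split; last by exists f.
by split=> [b x|x]; apply: (can_inj hK); rewrite /= ?f_act ?f_par !fK.
Qed.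

Lemma sh_letterP (K : numClosedFieldType) (cL cLa h ha : K) (b : SH K) :
  (exists i, b = sh_letter K i) \/ (exists c, verma_hw cL cLa h ha b = Some c).
Proof.
have letterE a (n : int) : n < 0 -> exists i,
    letter_osc i = a /\ - (i %/ 4)%:Z - 1 = n.
  move=> n0; exists (osc_letter a (absz n).-1).
  by rewrite osc_letterK osc_letter_div; split=> //; lia.
case: b => [n|n|n|n|||]; try (by right; eexists); have [n0|n0] := ltrP n 0;
  try by right; rewrite /=; do ?case: ifP; try (by eexists); lia.
- by left; have [i [iE nE]] := letterE Od n n0; exists i; rewrite /sh_letter iE nE.
- by left; have [i [iE nE]] := letterE Oc n n0; exists i; rewrite /sh_letter iE nE.
- by left; have [i [iE nE]] := letterE Opsip n n0; exists i; rewrite /sh_letter iE nE.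
- by left; have [i [iE nE]] := letterE Opsim n n0; exists i; rewrite /sh_letter iE nE.
Qed.

Unset Implicit Arguments.

Theorem proposition3p2 (R : realType) (cL cLa : R[i]) (hcLa : cLa != 0)
    (p r : R[i]) (hp : forall n : int, n < 0 -> p != n%:~R) :
  isomorphic (fock_pr cL cLa p r) (verma_pr cL cLa p r).
Proof.
set gamma := - ((p + 1) / 2) *: dbar cL + r *: vec_c _.
have F_mod : is_module (fock gamma) := hwmod_is_module (@fock_hw_odd _ gamma).
have F_hwv := hwgen_is_hwv (@fock_hw_odd _ gamma).
have F_ind := @hwmod_ind _ _ (fock_hw gamma).
have V_odd := @verma_hw_odd _ cL cLa (h_pr cL p r) ((1 + p) * cLa).
have V_mod : is_module (verma_pr cL cLa p r) := hwmod_is_module V_odd.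
have F_smooth := fock_smooth F_mod F_hwv F_ind.
have F_level := fock_level F_mod F_hwv F_ind.
have N_mod := free_field_is_module F_mod F_level F_smooth cL cLa.
have N_hwv := free_field_hwv F_mod F_hwv F_ind cLa (erefl gamma).
(* The canonical map from V[p,r] to F_{p,r}, sending generator to generator. *)
have [f [f_hom fv _]] := hwmod_universal V_odd N_mod N_hwv.
have f_lin : linear f by move=> a x y; rewrite linearP.
apply: (@isomorphic_of_bij _ _ _ _ f) => //.
apply: bijective_of_inj_surj => [x y fxy|x]; last first.
  exact: (free_field_surj F_mod F_hwv F_ind (erefl gamma) f_lin fv
    (proj1 f_hom) hcLa hp).
have [phi [phi_lin phi_act phi_vac]] := fock_occupation gamma.
have two0 : (2 : R[i]) != 0 by rewrite pnatr_eq0.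
apply/eqP; rewrite -subr_eq0; apply/eqP.
(* An element of the kernel is written in ordered words before leading terms are compared. *)
have := hwmod_ordered_span two0 V_odd (@sh_letterP _ cL cLa _ _) (x - y).
case=> s [s_ord xyE]; have : f (x - y) = 0 by rewrite linearB fxy subrr.
rewrite xyE; apply: (free_field_inj F_mod F_hwv F_ind (erefl gamma) f_lin fv
  (proj1 f_hom) hcLa hp phi_lin phi_vac phi_act s_ord).
Qed.
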